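(* Let $(X,d)$ be a countable metric space equipped with a positive measure $\pi$. Fix an integer $k\ge1$ and $s_0\in(0,2^{-1+1/k})$. There exist constants $C,c\in(0,\infty)$ (depending only on $k$ and $s_0$) such that, for any normal contraction $M$ on $\ell^2(X,\pi)$ satisfying $$d(x,y)>1\Longrightarrow M(x,y)=0$$ and whose spectrum is contained in $[a,1]$ with $a\in[-1,1)$ and $1-a\le2s_0$, we have, for all $x,y\in X$ and $n=1,2,\dots$, $$|M_k^n(x,y)|\le C\left(\frac{\pi(y)}{\pi(x)}\right)^{1/2}\exp\left(-c\left(\frac{d(x,y)}{n^{1/(2k)}}\right)^{\frac{2k}{2k-1}}\right).$$
   Context: $X$ is a countable set and $\pi(x)>0$ for every $x\in X$; $\ell^2(X,\pi)$ has inner product $\langle f,g\rangle_\pi=\sum_xf(x)\overline{g(x)}\pi(x)$. The operator $M$ acts on $\ell^2(X,\pi)$ through its matrix (kernel) $M(x,y)$ by $Mf(x)=\sum_yM(x,y)f(y)$. For fixed $k$, $M_k=I-(I-M)^k$, $M_k^n$ denotes the $n$-th power of the operator $M_k$, and $M_k^n(x,y)$ its matrix entries in the same sense, $M_k^nf(x)=\sum_yM_k^n(x,y)f(y)$. *)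

(* Defs.v *)
From HB Require Import structures.
From mathcomp Require Import all_boot all_order all_algebra finmap complex.
From mathcomp Require Import all_classical all_reals all_analysis.
From mathcomp Require Import ring lra.
From mathcomp.analysis.showcase Require Import summability.

Set Implicit Arguments.
Unset Strict Implicit.
Unset Printing Implicit Defensive.

Import Order.TTheory GRing.Theory Num.Theory numFieldNormedType.Exports.
Import ComplexField.Normc.

Local Open Scope classical_set_scope.
Local Open Scope ring_scope.
Local Open Scope complex_scope.

#[export] Existing Instance totally_filter.

Section Ell2.
Context {R : realType} {X : choiceType} (pi : X -> {posnum R}).
Implicit Types f g : X -> R[i].

Definition sqnorm f : \bar R :=
  \esum_(x in [set: X]) (normc (f x) ^+ 2 * (pi x)%:num)%:E.

Definition square_summable : {pred X -> R[i]} := [pred f | (sqnorm f < +oo)%E].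

Lemma normc_ge0 (z : R[i]) : 0 <= normc z.
Proof. by case: z => a b; exact: sqrtr_ge0. Qed.

Lemma sqnormZD (a : R[i]) f g :
  (sqnorm (a *: f + g)%R <=
   (2 * normc a ^+ 2)%R%:E * sqnorm f + 2%:E * sqnorm g)%E.
Proof.
have pw x : normc ((a *: f + g) x) ^+ 2 * (pi x)%:num <=
    (2 * normc a ^+ 2) * (normc (f x) ^+ 2 * (pi x)%:num) +
    2 * (normc (g x) ^+ 2 * (pi x)%:num).
  have -> : 2 * normc a ^+ 2 * (normc (f x) ^+ 2 * (pi x)%:num) +
      2 * (normc (g x) ^+ 2 * (pi x)%:num) =
      (2 * normc (a * f x) ^+ 2 + 2 * normc (g x) ^+ 2) * (pi x)%:num.
    by rewrite normcM exprMn; ring.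
  rewrite ler_wpM2r//.
  have -> : (a *: f + g) x = a * f x + g x by [].
  have := le_normcD (a * f x) (g x).
  set u := normc (a * f x); set v := normc (g x) => h.
  apply: (@le_trans _ _ ((u + v) ^+ 2)).
    by rewrite lerXn2r// nnegrE ?addr_ge0 ?normc_ge0.
  rewrite -subr_ge0.
  have -> : 2 * u ^+ 2 + 2 * v ^+ 2 - (u + v) ^+ 2 = (u - v) ^+ 2.
    by ring.
  exact: sqr_ge0.
have nn (h : X -> R[i]) x : (0 <= (normc (h x) ^+ 2 * (pi x)%:num)%:E)%E.
  by rewrite lee_fin mulr_ge0// sqr_ge0.
apply: ge_ereal_sup => _ [A [finA _]] <-.
apply: (@le_trans _ _ (\sum_(x \in A)
   ((2 * normc a ^+ 2)%R%:E * (normc (f x) ^+ 2 * (pi x)%:num)%:E +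
    2%:E * (normc (g x) ^+ 2 * (pi x)%:num)%:E))%E).
  by apply: lee_fsum => // x _; rewrite -!EFinM -EFinD lee_fin pw.
rewrite fsbig_split//= -!ge0_mule_fsumr//.
by rewrite leeD// lee_wpmul2l ?lee_fin ?mulr_ge0 ?normc_ge0//;
  apply: ereal_sup_ubound; exists A.
Qed.

Lemma sqnorm_ge0 f : (0 <= sqnorm f)%E.
Proof. by apply: esum_ge0 => x _; rewrite lee_fin mulr_ge0// sqr_ge0. Qed.

Lemma square_summable_submod : GRing.submod_closed square_summable.
Proof.
split.
  rewrite inE /sqnorm esum1 ?ltry// => x _.
  by rewrite normc0 expr0n mul0r.
move=> a f g; rewrite !inE => hf hg.
apply: (le_lt_trans (sqnormZD a f g)).
rewrite lte_add_pinfty//.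
  have ff : sqnorm f \is a fin_num by rewrite ge0_fin_numE// sqnorm_ge0.
  by rewrite -(fineK ff) -EFinM ltry.
have fg : sqnorm g \is a fin_num by rewrite ge0_fin_numE// sqnorm_ge0.
by rewrite -(fineK fg) -EFinM ltry.
Qed.

HB.instance Definition _ :=
  GRing.isSubmodClosed.Build R[i] (X -> R[i]) square_summable
    square_summable_submod.

Record ell2 := Ell2 {
  ell2_fun :> X -> R[i];
  _ : ell2_fun \in square_summable }.

HB.instance Definition _ := [isSub for ell2_fun].
HB.instance Definition _ := [Choice of ell2 by <:].
HB.instance Definition _ := [SubChoice_isSubLmodule of ell2 by <:].

Implicit Types (u v : ell2) (T : ell2 -> ell2).

Definition ell2_norm u : R := Num.sqrt (fine (sqnorm u)).

(* R[i] carries its topology through the alias R[i]^o; "sum" is the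
   unconditional sum, the limit of the partial sums over finite subsets. *)
Definition inner u v : R[i] :=
  sum (fun x => u x * (v x)^* * (pi x)%:num%:C : R[i]^o).

Definition bounded_op T : Prop :=
  exists B : R, forall u, ell2_norm (T u) <= B * ell2_norm u.

Definition contraction_op T : Prop := forall u, ell2_norm (T u) <= ell2_norm u.

Definition is_adjoint T S : Prop := forall u v, inner (T u) v = inner u (S v).

(* T commutes with its adjoint; a bounded operator has exactly one adjoint. *)
Definition normal_op T : Prop :=
  exists2 S : {linear ell2 -> ell2}, is_adjoint T S & T \o S = S \o T.

Definition spectrum T : set R[i] := [set z | ~ exists S : {linear ell2 -> ell2},
  [/\ bounded_op S, forall u, S (T u - z *: u) = u
    & forall u, T (S u) - z *: S u = u]].

(* K x y is the matrix of T: (T u)(x) = \sum_y K(x, y) u(y), where the sum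
   converges unconditionally (equivalently, absolutely). *)
Definition has_kernel T (K : X -> X -> R[i]) : Prop := forall u x,
  partial_sum (fun y => K x y * u y : R[i]^o) @ totally --> (T u x : R[i]^o).

(* I - (I - T)^k *)
Definition smoothed T (k : nat) : ell2 -> ell2 :=
  fun u => u - iter k (fun v => v - T v) u.

(* Every bounded operator has a kernel, namely (T delta_y)(x), and it is the
   only one. *)

Lemma delta_subproof y :
  (fun x => (x == y)%:R : R[i]) \in square_summable.
Proof.
rewrite inE /sqnorm.
rewrite (_ : esum _ _ = (pi y)%:num%:E) ?ltry//.
rewrite -[RHS](@esum_set1 R X y (fun y => (pi y)%:num%:E)) ?lee_fin//.
rewrite [RHS]esum_mkcond; apply: eq_esum => x _.
case: ifPn => [/set_mem -> | /negP xy].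
  by rewrite eqxx normc1 expr1n mul1r.
case: eqP => [xE|_]; last by rewrite normc0 expr0n mul0r.
by case: xy; rewrite xE; exact/mem_set.
Qed.

Definition ell2_delta y : ell2 := Ell2 (delta_subproof y).

Lemma has_kernel_delta T K x y :
  has_kernel T K -> K x y = T (ell2_delta y) x.
Proof.
move=> /(_ (ell2_delta y) x) h.
have : partial_sum (fun z => K x z * ell2_delta y z : R[i]^o) @ totally -->
    (K x y : R[i]^o).
  apply: cvg_near_cst; rewrite nearE; exists [fset y]%fset => // A /= yA.
  have yA' : y \in A by move/fsubsetP : yA; apply; rewrite inE.
  rewrite /partial_sum (bigD1 [` yA']%fset)//= eqxx mulr1 big1 ?addr0// => i.
  by rewrite -val_eqE /= => /negbTE ->; rewrite mulr0.
move/(cvg_unique (@norm_hausdorff _ R[i]^o)) => /(_ _ h).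
exact.
Qed.

Lemma ell2_norm_sqr u : ell2_norm u ^+ 2 = fine (sqnorm u).
Proof. by rewrite sqr_sqrtr// fine_ge0// sqnorm_ge0. Qed.

Lemma sqnorm_fin u : sqnorm u \is a fin_num.
Proof. by rewrite ge0_fin_numE ?sqnorm_ge0//; case: u. Qed.

Lemma ell2_eval_le u x : normc (u x) ^+ 2 * (pi x)%:num <= ell2_norm u ^+ 2.
Proof.
rewrite ell2_norm_sqr -lee_fin fineK ?sqnorm_fin//.
apply: esum_ge; exists [set x]; first by split.
by rewrite fsbig_set1.
Qed.

Lemma ell2_evalB u v x : (u - v) x = u x - v x.
Proof. by []. Qed.

Lemma ell2_evalZ (a : R[i]) u x : (a *: u) x = a * u x.
Proof. by []. Qed.

Lemma ell2_eval_sum (I : finType) (F : I -> ell2) x :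
  (\sum_i F i) x = \sum_i F i x.
Proof. exact: (big_morph (fun u : ell2 => u x)). Qed.

Definition truncate u (A : {fset X}) : ell2 :=
  \sum_(y : A) u (val y) *: ell2_delta (val y).

Lemma truncateE u (A : {fset X}) x :
  truncate u A x = if x \in A then u x else 0.
Proof.
rewrite ell2_eval_sum.
rewrite (eq_bigr (fun y : A => u (val y) * (x == val y)%:R))//.
case: ifPn => xA.
  rewrite (bigD1 [` xA]%fset)//= big1 ?addr0 => [|i].
    by rewrite eqxx mulr1.
  by rewrite -val_eqE /= eq_sym => /negbTE ->; rewrite mulr0.
rewrite big1// => i _ /=; case: eqP => [e|]; last by rewrite mulr0.
by move: xA; rewrite e (valP i).
Qed.

Lemma truncate_cvg u (e : R) : 0 < e ->
  \forall A \near totally, ell2_norm (u - truncate u A) ^+ 2 < e.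
Proof.
move=> e0.
pose F x : \bar R := (normc (u x) ^+ 2 * (pi x)%:num)%:E.
have F0 x : (0 <= F x)%E by rewrite lee_fin mulr_ge0// sqr_ge0.
have [_ [D [finD _] <-]] := ub_ereal_sup_adherent e0 (sqnorm_fin u).
rewrite -/(sqnorm u) => hD.
rewrite nearE; exists (fset_set D) => // A /= DA.
rewrite ell2_norm_sqr -lte_fin fineK ?sqnorm_fin//.
have -> : sqnorm (u - truncate u A) = \esum_(x in ~` [set` A]) F x.
  rewrite esum_mkcond; apply: eq_esum => x _.
  rewrite ell2_evalB truncateE in_setC; case: ifPn => xA.
    by rewrite mem_set// subrr normc0 expr0n mul0r.
  by rewrite memNset/= ?subr0//; apply/negP.
apply: (@le_lt_trans _ _ (\esum_(x in ~` D) F x)).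
  rewrite esum_mkcond [leRHS]esum_mkcond; apply: le_esum => x _.
  rewrite !in_setC; case: (boolP (x \in D)) => xD /=; last by case: ifP.
  rewrite mem_set//=; apply: (fsubsetP DA).
  by rewrite in_fset_set.
have := @esumID R X D [set: X] F (fun x _ => F0 x).
rewrite !setTI -/(sqnorm u) (@esum_fset _ _ D)// => hu.
move: hD; rewrite -[ereal_sup _]/(sqnorm u) {1}hu.
have Dfin : (\sum_(x \in D) F x)%E \is a fin_num.
  rewrite -esum_fset// ge0_fin_numE ?esum_ge0//.
  have := sqnorm_fin u; rewrite ge0_fin_numE ?sqnorm_ge0//.
  by apply: le_lt_trans; rewrite hu esum_fset// leeDl// esum_ge0.
have Cfin : \esum_(x in ~` D) F x \is a fin_num.
  rewrite ge0_fin_numE ?esum_ge0//.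
  have := sqnorm_fin u; rewrite ge0_fin_numE ?sqnorm_ge0//.
  by apply: le_lt_trans; rewrite hu leeDr// fsume_ge0.
rewrite -/F -[X in (_ < X)%E -> _]/(\sum_(x \in D) F x)%E.
move: Dfin Cfin; case: (\sum_(x \in D) F x)%E => // s _.
case: (\esum_(x in ~` D) F x) => // t _.
by rewrite !lte_fin; lra.
Qed.

Lemma bounded_has_kernel (T : {linear ell2 -> ell2}) : bounded_op T ->
  has_kernel T (fun x y => T (ell2_delta y) x).
Proof.
move=> [B TB] u x; apply/cvgrPdist_lt => eps eps0.
have epsE : eps = (complex.Re eps)%:C by rewrite RRe_real// gtr0_real.
set e := complex.Re eps in epsE; rewrite epsE ltcR in eps0 *.
have d0 : 0 < e ^+ 2 * (pi x)%:num / (B ^+ 2 + 1).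
  by rewrite divr_gt0 ?mulr_gt0 ?exprn_gt0// ltr_wpDl ?sqr_ge0.
apply: filterS (truncate_cvg u d0) => A; set w := u - truncate u A => hw.
have -> : partial_sum (fun y => T (ell2_delta y) x * u y : R[i]^o) A =
    T (truncate u A) x.
  rewrite linear_sum ell2_eval_sum; apply: eq_bigr => y _.
  by rewrite linearZ /= mulrC.
rewrite -ell2_evalB -linearB -/w.
rewrite -[X in X < _]/((normc (T w x))%:C) ltcR.
have h1 := ell2_eval_le (T w) x.
have h2 : ell2_norm (T w) ^+ 2 <= B ^+ 2 * ell2_norm w ^+ 2.
  rewrite -exprMn lerXn2r ?nnegrE//; first exact: sqrtr_ge0.
  by apply: le_trans (TB w); exact: sqrtr_ge0.
have h3 : (B ^+ 2 + 1) * ell2_norm w ^+ 2 < e ^+ 2 * (pi x)%:num.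
  by rewrite mulrC -ltr_pdivlMr// ltr_wpDl ?sqr_ge0.
have h4 : normc (T w x) ^+ 2 < e ^+ 2.
  rewrite -(ltr_pM2r (x := (pi x)%:num))//.
  apply: le_lt_trans h1 (le_lt_trans h2 (le_lt_trans _ h3)).
  by rewrite ler_wpM2r ?sqr_ge0// lerDl.
by move: h4; rewrite ltr_pXn2r// nnegrE ?normc_ge0// ltW.
Qed.

End Ell2.

(* Main.v *)
Require Import Defs.
From HB Require Import structures.
From mathcomp Require Import all_boot all_order all_algebra finmap complex.
From mathcomp Require Import all_classical all_reals all_analysis.
From mathcomp Require Import ring lra zify.
From mathcomp.analysis.showcase Require Import summability.

Import Order.TTheory GRing.Theory Num.Theory numFieldNormedType.Exports.
Import ComplexField.Normc.

Set Implicit Arguments.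
Unset Strict Implicit.
Unset Printing Implicit Defensive.

Local Open Scope classical_set_scope.
Local Open Scope ring_scope.
Local Open Scope complex_scope.

(** Finite propagation turns the estimate into a problem of polynomial
approximation.  A polynomial of degree l in M cannot move mass farther than l,
so only the part of degree at least d(x, y) of M_k^n = (1 - (1 - M)^k)^n is seen
by the entry (x, y).

The polynomial is expanded in Chebyshev polynomials of the symmetric operator
A = 1 - (1 - M) / s0, that is, M_k^n = \sum_l b_l T_l(A).  The hypotheses on M
make A a symmetric contraction, and then each T_l(A) is a contraction as well,
because 1 - T_l^2 = (1 - X^2) U_{l-1}^2.  Consequently
|M_k^n(x, y)| <= (pi y / pi x)^(1/2) \sum_(l >= d(x, y)) |b_l|
(lemma [smoothed_entry_le]), and the rest concerns the numbers b_l, which depend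
on k, n and s0 alone.

Two facts about M enter.  A normal operator with real spectrum is symmetric
([normal_real_spectrum_symmetric]), and a lower bound of the spectrum of a
symmetric operator bounds its quadratic form from below
([spectrum_lower_bound]).  Both come from one lemma, [approx_eigenvectors]: on
the approximate kernel of an operator D commuting with H, the infimum of the
quadratic form of H is an approximate eigenvalue of H.

For the b_l, the expansion is a Laurent polynomial in z once X = (z + 1/z) / 2.
Sampling it at z = rho w^j, w a primitive root of unity of large order N, gives
b_l rho^l as a discrete Fourier coefficient
([fourier_coefficient_bound]).  With z = (1 + h) exp(i theta) the symbol obeys
|1 - (s0 (1 - X))^k| <= exp(- c (1 - cos theta)^k + C h^(2k))
([symbol_bound]).  The condition s0 < 2^(-1+1/k) means (2 s0)^k < 2: the symbol
stays away from -1 at theta = pi, so that it has modulus 1 only at theta = 0.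
Averaging the n-th power over theta yields
|b_l| <= B n^(-1/(2k)) exp(C n h^(2k)) (1 + h)^(-l), where the prefactor
n^(-1/(2k)) comes from the decay in theta and compensates the factor 1 / h
produced by the geometric sum over l >= d.  Taking h proportional to
(d / n)^(1/(2k-1)), and to n^(-1/(2k)) when d is smaller than n^(1/(2k)), gives
the stated exponent ([optimal_shift]). *)

(** * Moduli of complex numbers and plain linear maps *)

Section Preliminaries.
Context {R : realType}.

Lemma normc_real (x : R) : normc x%:C = `|x|.
Proof. by rewrite /= expr0n addr0 sqrtr_sqr. Qed.

Lemma normcX (z : R[i]) m : normc (z ^+ m) = normc z ^+ m.
Proof. by elim: m => [|m IH]; rewrite ?expr0 ?normc1// !exprS normcM IH. Qed.

Lemma normc_sum (I : Type) (s : seq I) (P : pred I) (F : I -> R[i]) :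
  normc (\sum_(i <- s | P i) F i) <= \sum_(i <- s | P i) normc (F i).
Proof.
elim/big_rec2 : _ => [|i y1 y2 _ h]; first by rewrite normc0.
by apply: le_trans (le_normcD _ _) _; rewrite lerD2l.
Qed.

Lemma mul_conj_normc (z : R[i]) : z * Num.conj z = (normc z ^+ 2)%:C.
Proof. by rewrite -sqr_normc rmorphXn. Qed.

Lemma linear_morphB (K : pzRingType) (U V : lmodType K) (f : U -> V) :
  linear f -> {morph f : u v / u - v}.
Proof. by move=> fl u v; rewrite -scaleN1r addrC fl scaleN1r addrC. Qed.

Lemma linear_morphD (K : pzRingType) (U V : lmodType K) (f : U -> V) :
  linear f -> {morph f : u v / u + v}.
Proof. by move=> fl u v; rewrite -[u]scale1r fl !scale1r. Qed.

Lemma linear_morph0 (K : pzRingType) (U V : lmodType K) (f : U -> V) :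
  linear f -> f 0 = 0.
Proof. by move=> fl; have := linear_morphB fl 0 0; rewrite !subrr. Qed.

End Preliminaries.


(** * The inner product as a scalar product *)

Section InnerProduct.
Context {R : realType} {X : choiceType} (pi : X -> {posnum R}).
Implicit Types u v w : ell2 pi.

Definition inner_term u v x : R[i]^o := u x * (v x)^* * (pi x)%:num%:C.

Lemma ell2_evalD u v x : (u + v) x = u x + v x.
Proof. by []. Qed.

Lemma truncate_sqnorm u (A : {fset X}) :
  ell2_norm u ^+ 2 - ell2_norm (u - truncate u A) ^+ 2 =
  \sum_(x : A) normc (u (val x)) ^+ 2 * (pi (val x))%:num.
Proof.
pose F x : \bar R := (normc (u x) ^+ 2 * (pi x)%:num)%:E.
have F0 x : (0 <= F x)%E by rewrite lee_fin mulr_ge0// sqr_ge0.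
have tailE : sqnorm pi (u - truncate u A) = \esum_(x in ~` [set` A]) F x.
  rewrite esum_mkcond; apply: eq_esum => x _.
  rewrite ell2_evalB truncateE in_setC; case: ifPn => xA.
    by rewrite mem_set// subrr normc0 expr0n mul0r.
  by rewrite memNset/= ?subr0//; apply/negP.
have := @esumID R X [set` A] [set: X] F (fun x _ => F0 x).
rewrite !setTI -/(sqnorm pi u) (@esum_fset _ _ [set` A])//.
rewrite -fsbig_seq// big_seq_fsetE/= /F sumEFin => split_u.
rewrite !ell2_norm_sqr.
have -> : fine (sqnorm pi u) =
   \sum_(x : A) normc (u (val x)) ^+ 2 * (pi (val x))%:num +
   fine (sqnorm pi (u - truncate u A)).
  have := sqnorm_fin (u - truncate u A); rewrite tailE => fin_tail.
  by rewrite split_u fineD.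
by rewrite addrK.
Qed.

Lemma inner_self_cvg u : partial_sum (inner_term u u) @ totally -->
  ((ell2_norm u ^+ 2)%:C : R[i]^o).
Proof.
apply/cvgrPdist_lt => eps eps0.
have epsE : eps = (complex.Re eps)%:C by rewrite RRe_real// gtr0_real.
rewrite epsE ltcR in eps0 *.
apply: filterS (truncate_cvg u eps0) => A uA.
have -> : partial_sum (inner_term u u) A =
    (ell2_norm u ^+ 2 - ell2_norm (u - truncate u A) ^+ 2)%:C.
  rewrite truncate_sqnorm rmorph_sum; apply: eq_bigr => x _.
  by rewrite /inner_term mul_conj_normc -rmorphM.
rewrite -[X in `|X|]rmorphB subKr -[X in X < _]/((normc _)%:C) ltcR.
by rewrite /= expr0n addr0 sqrtr_sqr ger0_norm// sqr_ge0.
Qed.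

(** Summability of the products follows from that of the squares by polarization,
which writes the partial sums for (u, v) as combinations of four partial sums of
squares. *)
Lemma inner_cvg u v :
  partial_sum (inner_term u v) @ totally --> (inner u v : R[i]^o).
Proof.
suff : cvg (partial_sum (inner_term u v) @ totally) by [].
apply/cvg_ex; exists ((4^-1 : R[i]) *: (
    ((ell2_norm (u + v) ^+ 2)%:C : R[i]^o) - (ell2_norm (u - v) ^+ 2)%:C +
    'i%C *: ((ell2_norm (u + 'i%C *: v) ^+ 2)%:C : R[i]^o) -
    'i%C *: ((ell2_norm (u - 'i%C *: v) ^+ 2)%:C : R[i]^o)) : R[i]^o).
rewrite (_ : partial_sum _ = fun A => (4^-1 : R[i]) *: (
    (partial_sum (inner_term (u + v) (u + v)) A : R[i]^o) -
    partial_sum (inner_term (u - v) (u - v)) A +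
    'i%C *: (partial_sum (inner_term (u + 'i%C *: v) (u + 'i%C *: v)) A
             : R[i]^o) -
    'i%C *: (partial_sum (inner_term (u - 'i%C *: v) (u - 'i%C *: v)) A
             : R[i]^o)) : R[i]^o); last first.
  apply/funext => A; rewrite /partial_sum.
  rewrite !scaler_sumr -!sumrB -!big_split -sumrB scaler_sumr.
  apply: eq_bigr => x _.
  rewrite /inner_term.
  rewrite !(ell2_evalB, ell2_evalD, ell2_evalZ).
  rewrite !(rmorphD, rmorphN, rmorphM) /=.
  have -> : Num.conj ('i%C : R[i]) = - 'i%C.
    by apply/eqP; rewrite eq_complex/= oppr0 !eqxx.
  rewrite /GRing.scale /=.
  move: (u (val x)) (v (val x)) (Num.conj (u (val x)))
    (Num.conj (v (val x))) => a b c d.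
  have ii : ('i%C : R[i]) * 'i%C = -1 by rewrite -expr2 sqr_i.
  by field: ii.
have cvgc (e : R[i]) (f : {fset X} -> R[i]^o) (l : R[i]^o) : f @ totally --> l ->
    (fun A => e *: f A) @ totally --> e *: l.
  by move=> fl; apply: (@cvgZl_tmp _ R[i]^o _ _ _ e f l fl).
apply: (cvgc); apply: cvgB; last by apply: (cvgc); exact: inner_self_cvg.
apply: cvgD; last by apply: (cvgc); exact: inner_self_cvg.
by apply: cvgB; exact: inner_self_cvg.
Qed.

Lemma inner_unique u v l :
  partial_sum (inner_term u v) @ totally --> (l : R[i]^o) -> inner u v = l.
Proof.
move=> h; have := @inner_cvg u v.
by move/(cvg_unique (@norm_hausdorff _ R[i]^o)) => /(_ _ h).
Qed.

Lemma inner_linear c u v w :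
  inner (c *: u + v) w = c * inner u w + inner v w.
Proof.
apply: inner_unique.
rewrite (_ : partial_sum _ = fun A =>
    c *: (partial_sum (inner_term u w) A : R[i]^o) +
    partial_sum (inner_term v w) A); last first.
  apply/funext => A; rewrite /partial_sum scaler_sumr -big_split.
  apply: eq_bigr => x _; rewrite /inner_term ell2_evalD ell2_evalZ.
  by rewrite /GRing.scale/= !mulrDl !mulrA.
apply: cvgD (@inner_cvg v w); apply: cvgZ (@inner_cvg u w); exact: cvg_cst.
Qed.

Lemma inner0l w : inner 0 w = 0.
Proof.
have := inner_linear 1 0 0 w; rewrite scale1r addr0 mul1r => /eqP.
by rewrite -subr_eq subrr eq_sym => /eqP.
Qed.

Lemma innerDl u v w : inner (u + v) w = inner u w + inner v w.
Proof. by rewrite -[u]scale1r inner_linear mul1r scale1r. Qed.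

Lemma innerZl c u w : inner (c *: u) w = c * inner u w.
Proof. by rewrite -[c *: u]addr0 inner_linear inner0l addr0. Qed.

Lemma innerNl u w : inner (- u) w = - inner u w.
Proof. by rewrite -scaleN1r innerZl mulN1r. Qed.

Lemma inner_conj u v : inner v u = Num.conj (inner u v).
Proof.
apply: inner_unique; apply/cvgrPdist_lt => eps eps0.
move/cvgrPdist_lt : (@inner_cvg u v) => /(_ _ eps0).
apply: filterS => A; congr (_ < _).
rewrite -[LHS]norm_conjC rmorphB /= rmorph_sum; congr (`|_ - _|).
apply: eq_bigr => x _; rewrite /inner_term !rmorphM /= conjCK.
by congr (_ * _); [rewrite mulrC | exact: conjc_real].
Qed.

Lemma inner_self u : inner u u = (ell2_norm u ^+ 2)%:C.
Proof. by apply: inner_unique; exact: inner_self_cvg. Qed.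

(** Quadratic forms of symmetric operators are real, so their inequalities are
stated with the real part. *)
Definition dot u v : R := complex.Re (inner u v).

Lemma dotC u v : dot u v = dot v u.
Proof. by rewrite /dot inner_conj; case: (inner v u). Qed.

Lemma dotDl u v w : dot (u + v) w = dot u w + dot v w.
Proof. by rewrite /dot innerDl; case: (inner u w) => ? ?; case: (inner v w). Qed.

Lemma dotZl (r : R) u v : dot (r%:C *: u) v = r * dot u v.
Proof. by rewrite /dot innerZl; case: (inner u v) => a b /=; rewrite mul0r subr0. Qed.

Lemma dotDr u v w : dot u (v + w) = dot u v + dot u w.
Proof. by rewrite dotC dotDl !(dotC u). Qed.

Lemma dotZr (r : R) u v : dot u (r%:C *: v) = r * dot u v.
Proof. by rewrite dotC dotZl dotC. Qed.

Lemma dotNl u v : dot (- u) v = - dot u v.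
Proof. by rewrite -[RHS]mulN1r -dotZl rmorphN1 scaleN1r. Qed.

Lemma dotNr u v : dot u (- v) = - dot u v.
Proof. by rewrite dotC dotNl dotC. Qed.

Lemma dotBl u v w : dot (u - v) w = dot u w - dot v w.
Proof. by rewrite dotDl dotNl. Qed.

Lemma dotBr u v w : dot u (v - w) = dot u v - dot u w.
Proof. by rewrite dotDr dotNr. Qed.

Lemma dot_self u : dot u u = ell2_norm u ^+ 2.
Proof. by rewrite /dot inner_self. Qed.

Lemma ell2_norm_ge0 u : 0 <= ell2_norm u.
Proof. exact: sqrtr_ge0. Qed.

Lemma dot_le u v : dot u v <= ell2_norm u * ell2_norm v.
Proof.
set a := ell2_norm u; set b := ell2_norm v.
have a0 : 0 <= a := ell2_norm_ge0 u; have b0 : 0 <= b := ell2_norm_ge0 v.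
have sq (s t : R) : 0 <= s ^+ 2 * a ^+ 2 + t ^+ 2 * b ^+ 2 - 2 * s * t * dot u v.
  have -> : s ^+ 2 * a ^+ 2 + t ^+ 2 * b ^+ 2 - 2 * s * t * dot u v =
      ell2_norm (s%:C *: u - t%:C *: v) ^+ 2.
    rewrite -dot_self dotBl !dotBr !dotZl !dotZr !dot_self (dotC v u) -/a -/b.
    by ring.
  exact: sqr_ge0.
(* for a zero norm, a large coefficient on that side forces dot u v = 0 *)
have [a00|an0] := eqVneq a 0.
  have := sq (b ^+ 2 + 1) (dot u v); rewrite a00 => h.
  rewrite mul0r leNgt; apply/negP => d0.
  have : 0 < (dot u v) ^+ 2 by rewrite exprn_gt0.
  have b2 := sqr_ge0 b.
  by nra.
have [b00|bn0] := eqVneq b 0.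
  have := sq (dot u v) (a ^+ 2 + 1); rewrite b00 => h.
  rewrite mulr0 leNgt; apply/negP => d0.
  have : 0 < (dot u v) ^+ 2 by rewrite exprn_gt0.
  have a2 := sqr_ge0 a.
  by nra.
have ap : 0 < a by rewrite lt_def an0.
have bp : 0 < b by rewrite lt_def bn0.
have := sq b a.
have -> : b ^+ 2 * a ^+ 2 + a ^+ 2 * b ^+ 2 - 2 * b * a * dot u v =
  2 * (a * b) * (a * b - dot u v) by ring.
by rewrite pmulr_rge0 ?subr_ge0// !mulr_gt0.
Qed.

Lemma ell2_normZc (c : R[i]) u : ell2_norm (c *: u) = normc c * ell2_norm u.
Proof.
apply/eqP; rewrite -(@eqrXn2 _ 2)// ?mulr_ge0 ?ell2_norm_ge0 ?normc_ge0//.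
apply/eqP/(@complexI R); rewrite -inner_self.
rewrite innerZl [X in c * X]inner_conj innerZl rmorphM /= inner_self mulrA.
by rewrite mul_conj_normc [X in _ * X]conjc_real -rmorphM exprMn.
Qed.

Lemma ell2_normZ (r : R) u : ell2_norm (r%:C *: u) = `|r| * ell2_norm u.
Proof. by rewrite ell2_normZc normc_real. Qed.

Lemma ell2_norm0 : ell2_norm (0 : ell2 pi) = 0.
Proof. by rewrite -(scale0r 0) ell2_normZc normc0 mul0r. Qed.

Lemma ell2_normN u : ell2_norm (- u) = ell2_norm u.
Proof. by rewrite -scaleN1r -(rmorphN1 (real_complex R)) ell2_normZ normrN1 mul1r. Qed.

Lemma ell2_normD u v : ell2_norm (u + v) <= ell2_norm u + ell2_norm v.
Proof.
rewrite -ler_sqr ?nnegrE ?addr_ge0 ?ell2_norm_ge0//.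
rewrite -dot_self dotDl !dotDr !dot_self (dotC v u).
by have := dot_le u v; nra.
Qed.

Lemma ell2_normB u v : ell2_norm (u - v) <= ell2_norm u + ell2_norm v.
Proof. by rewrite -(ell2_normN v); exact: ell2_normD. Qed.

End InnerProduct.

(** * Approximate eigenvectors of commuting symmetric operators *)

Section ApproximateEigenvectors.
Context {R : realType} {X : choiceType} (pi : X -> {posnum R}).
Implicit Types (u v w : ell2 pi) (H D : ell2 pi -> ell2 pi).
Local Notation nrm := ell2_norm.

(** Vectors nearly killed by D form a family stable under H, since D and H commute.
Let l be the limit of the infima of the quadratic form of H over those families.
Near a minimizer u the residual L u, with L = H - l, must be small: replacing u by
u - t L u stays in a nearby family and would lower the form by about
2 t |L u|^2, below its infimum.  With D = 0 this gives an approximate eigenvalue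
at the bottom of the form; with D = K - mu it gives joint approximate eigenvectors
of H and K. *)
Lemma approx_eigenvectors H D (h : R) :
  linear H -> linear D ->
  (forall u v, dot (H u) v = dot u (H v)) ->
  (forall u, nrm (H u) <= h * nrm u) ->
  (forall u, D (H u) = H (D u)) ->
  (forall e, 0 < e -> exists u, 0 < nrm u /\ nrm (D u) <= e * nrm u) ->
  exists l : R,
    (forall e, 0 < e -> exists u, [/\ 0 < nrm u, nrm (D u) <= e * nrm u &
        nrm (H u - l%:C *: u) <= e * nrm u]) /\
    (forall u, D u = 0 -> l * nrm u ^+ 2 <= dot (H u) u).
Proof.
move=> Hlin Dlin Hsym Hbd DH Dapx.
have abs_dot v w : `|dot v w| <= nrm v * nrm w.
  by rewrite ler_norml dot_le andbT lerNl -dotNl -(ell2_normN v) dot_le.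
have Hdot u : `|dot (H u) u| <= h * nrm u ^+ 2.
  apply: le_trans (abs_dot _ _) _; rewrite expr2 mulrA.
  by rewrite ler_wpM2r ?ell2_norm_ge0.
pose Lam := [set l : R | exists2 e, 0 < e & forall u,
  nrm (D u) <= e * nrm u -> l * nrm u ^+ 2 <= dot (H u) u].
have supLam : has_sup Lam.
  split.
    exists (- h); exists 1 => // u _.
    by have := Hdot u; rewrite ler_norml mulNr => /andP[].
  exists h => l [e e0 he]; have [u [u0 ue]] := Dapx _ e0.
  have := le_trans (he _ ue) (le_trans (ler_norm _) (Hdot u)).
  by rewrite ler_pM2r// exprn_gt0.
exists (sup Lam); set l := sup Lam.
have low d : 0 < d -> exists2 e, 0 < e & forall u,
    nrm (D u) <= e * nrm u -> (l - d) * nrm u ^+ 2 <= dot (H u) u.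
  move=> d0; have [m [e e0 he] lm] := sup_adherent d0 supLam.
  exists e => // u /he; apply: le_trans; rewrite ler_wpM2r ?sqr_ge0//.
  exact: ltW.
have up d e : 0 < d -> 0 < e -> exists u, [/\ 0 < nrm u,
    nrm (D u) <= e * nrm u & dot (H u) u <= (l + d) * nrm u ^+ 2].
  move=> d0 e0; apply: contrapT => no.
  have : Lam (l + d).
    exists e => // u ue; rewrite leNgt; apply/negP => hu; apply: no; exists u.
    split => //; last exact: ltW.
    rewrite lt_def ell2_norm_ge0 andbT; apply/eqP => u0.
    have := Hdot u; move: hu; rewrite u0 expr0n !mulr0 => hu.
    by rewrite normr_le0 => /eqP; lra.
  move/(ub_le_sup supLam.2); rewrite -/l; lra.
split; last first.
  move=> u Du0; apply/ler_addgt0Pl => d d0.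
  have [u0|un0] := eqVneq (nrm u) 0.
    rewrite u0 expr0n mulr0.
    by have := Hdot u; rewrite u0 expr0n mulr0 normr_le0 => /eqP ->; lra.
  have up0 : 0 < nrm u ^+ 2 by rewrite exprn_gt0// lt_def un0 ell2_norm_ge0.
  have [e e0 /(_ u)] := low (d / nrm u ^+ 2) (divr_gt0 d0 up0).
  have -> : nrm (D u) = 0.
    by rewrite Du0 ell2_norm0.
  rewrite mulr_ge0 ?ell2_norm_ge0 ?(ltW e0)// => /(_ isT).
  by rewrite mulrBl divfK ?lt0r_neq0//; lra.
move=> eps eps0.
set c := h + `|l| + 1.
have [u1 [u10 _ _]] := up 1 1 ltr01 ltr01.
have h0 : 0 <= h.
  by rewrite -(pmulr_lge0 _ u10); apply: le_trans (Hbd u1); exact: ell2_norm_ge0.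
have c0 : 0 < c by rewrite /c ltr_wpDl ?addr_ge0.
pose L u := H u - l%:C *: u.
have Lbd u : nrm (L u) <= c * nrm u.
  apply: le_trans (ell2_normB _ _) _; rewrite ell2_normZ /c.
  by have := Hbd u; have := ell2_norm_ge0 u; lra.
have Llin a u v : L (a *: u + v) = a *: L u + L v.
  rewrite /L Hlin !scalerDr !scalerN !scalerA (mulrC _ a) opprD.
  by rewrite addrACA.
have Lsym u v : dot (L u) v = dot u (L v).
  by rewrite dotBl dotBr dotZl dotZr Hsym.
have DL u : D (L u) = L (D u).
  have D_scaleB (a : R[i]) v w : D (v - a *: w) = D v - a *: D w.
    by rewrite -!scaleNr ![_ + _ *: _]addrC Dlin.
  by rewrite /L D_scaleB DH.
have Ldot u : dot (L u) u = dot (H u) u - l * nrm u ^+ 2.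
  by rewrite /L dotBl dotZl dot_self.
have LE u : H u - l%:C *: u = L u by [].
clearbody L.
(* c bounds the norm of L; this t makes u and its trial vector comparable *)
pose t : R := (2 * c)^-1.
have t0 : 0 < t by rewrite invr_gt0 mulr_gt0.
have tc : t * c = 2^-1 by rewrite /t invfM mulfVK// lt0r_neq0.
(* the tolerance for which the last inequality of the proof gives eps exactly *)
pose d : R := 3 / 10 * t * eps ^+ 2.
have d0 : 0 < d by rewrite !mulr_gt0// ?exprn_gt0.
have [e1 e10 lowe] := low d d0.
have e20 : 0 < Num.min eps (e1 / 3) by rewrite lt_min eps0 divr_gt0.
have [u [u0 Du Hu]] := up d _ d0 e20.
have un : 0 <= nrm u by exact: ltW.
exists u; split => //.
  by apply: le_trans Du _; rewrite ler_wpM2r// ge_min lexx.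
rewrite LE.
pose v := u - t%:C *: L u.
have tLu : nrm (t%:C *: L u) <= nrm u / 2.
  rewrite ell2_normZ gtr0_norm//; apply: le_trans (ler_wpM2l (ltW t0) (Lbd u)) _.
  by rewrite mulrA tc mulrC.
have vlo : nrm u / 2 <= nrm v.
  have : nrm u <= nrm v + nrm (t%:C *: L u).
    by apply: le_trans (ell2_normD _ _); rewrite subrK.
  by lra.
have vhi : nrm v <= 2 * nrm u.
  by apply: le_trans (ell2_normB _ _) _; lra.
have Dv : nrm (D v) <= e1 * nrm v.
  have -> : D v = D u - t%:C *: L (D u).
    by rewrite /v -scaleNr addrC Dlin DL scaleNr addrC.
  apply: le_trans (ell2_normB _ _) _; rewrite ell2_normZ gtr0_norm//.
  have h1 : t * nrm (L (D u)) <= nrm (D u) / 2.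
    apply: le_trans (ler_wpM2l (ltW t0) (Lbd _)) _.
    by rewrite mulrA tc mulrC.
  have h2 : nrm (D u) <= e1 / 3 * nrm u.
    by apply: le_trans Du _; rewrite ler_wpM2r// ge_min lexx orbT.
  have h3 : e1 * (nrm u / 2) <= e1 * nrm v by rewrite ler_wpM2l// ltW.
  by lra.
have Lv : - d * nrm v ^+ 2 <= dot (L v) v.
  rewrite Ldot.
  by have := lowe v Dv; rewrite mulrBl mulNr; lra.
have v2 : nrm v ^+ 2 <= 4 * nrm u ^+ 2.
  have -> : 4 * nrm u ^+ 2 = (2 * nrm u) ^+ 2 by ring.
  by rewrite ler_sqr ?nnegrE ?mulr_ge0 ?ell2_norm_ge0.
have LLu : dot (L (L u)) (L u) <= c * nrm (L u) ^+ 2.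
  apply: le_trans (dot_le _ _) _; rewrite expr2 mulrA.
  by rewrite ler_wpM2r ?ell2_norm_ge0.
have Luu : dot (L u) u <= d * nrm u ^+ 2.
  rewrite Ldot.
  by move: Hu; rewrite mulrDl; lra.
have LvE : dot (L v) v =
    dot (L u) u - 2 * t * nrm (L u) ^+ 2 + t ^+ 2 * dot (L (L u)) (L u).
  have -> : L v = L u - t%:C *: L (L u).
    by rewrite /v -scaleNr addrC Llin scaleNr addrC.
  rewrite /v dotBl !dotBr !dotZl !dotZr (Lsym (L u) u) dot_self.
  by ring.
have tt : t ^+ 2 * dot (L (L u)) (L u) <= t / 2 * nrm (L u) ^+ 2.
  have -> : t / 2 = t ^+ 2 * c by rewrite expr2 -mulrA tc.
  by rewrite -mulrA ler_wpM2l ?sqr_ge0.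
have dv : d * nrm v ^+ 2 <= d * (4 * nrm u ^+ 2) by rewrite ler_wpM2l// ltW.
have key : 3 / 2 * t * nrm (L u) ^+ 2 <= 5 * d * nrm u ^+ 2.
  by move: Lv; rewrite LvE mulNr; lra.
rewrite -ler_sqr ?nnegrE ?mulr_ge0 ?ell2_norm_ge0 ?(ltW eps0)//.
rewrite exprMn -(@ler_pM2l _ (3 / 2 * t)) ?mulr_gt0//.
by apply: le_trans key _; rewrite /d; lra.
Qed.

End ApproximateEigenvectors.

(** * Normal contractions with real spectrum *)

Section NormalOperators.
Context {R : realType} {X : choiceType} (pi : X -> {posnum R}).
Implicit Types (u v w : ell2 pi) (T A : {linear ell2 pi -> ell2 pi}).
Local Notation nrm := ell2_norm.

(** A bounded inverse of T - z would bound |u| by a multiple of |T u - z u|. *)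
Lemma approx_eigenvalue_spectrum T (z : R[i]) :
  (forall e, 0 < e -> exists2 u, 0 < nrm u & nrm (T u - z *: u) <= e * nrm u) ->
  spectrum T z.
Proof.
move=> apx [S [[B SB] ST _]].
have e0 : 0 < (2 * (`|B| + 1))^-1 by rewrite invr_gt0 mulr_gt0// ltr_wpDl.
have [u u0 ue] := apx _ e0.
have := SB (T u - z *: u); rewrite ST => h1.
have h2 : B * nrm (T u - z *: u) <= (`|B| + 1) * nrm (T u - z *: u).
  by rewrite ler_wpM2r ?ell2_norm_ge0//; have := ler_norm B; lra.
have h3 : (`|B| + 1) * nrm (T u - z *: u) <=
    (`|B| + 1) * ((2 * (`|B| + 1))^-1 * nrm u).
  by rewrite ler_wpM2l// addr_ge0.
have h4 : (`|B| + 1) * ((2 * (`|B| + 1))^-1 * nrm u) = nrm u / 2.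
  by field; have := normr_ge0 B; lra.
by move: h1 h2 h3; rewrite h4; lra.
Qed.

(** For j = 'i or j = - 'i the operator j (S - T) is, up to sign, twice the imaginary
part of T.  Keeping j general handles both signs at once. *)
Lemma imaginary_part_symmetric T (S : {linear ell2 pi -> ell2 pi}) (j : R[i]) :
  is_adjoint T S -> Num.conj j = - j -> forall u v,
  dot (j *: (S u - T u)) v = dot u (j *: (S v - T v)).
Proof.
move=> adj cj u v.
have adj' w w' : inner (S w) w' = inner w (T w').
  by rewrite inner_conj -adj -inner_conj.
rewrite /dot; congr complex.Re.
have adjE : Num.conj (inner (S v) u - inner (T v) u) =
    inner (T u) v - inner (S u) v.
  rewrite rmorphB (adj u v) (adj' u v).
  by rewrite (inner_conj (S v) u) (inner_conj (T v) u).
rewrite [RHS]inner_conj !innerZl [Num.conj _]rmorphM !innerDl !innerNl.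
by rewrite [X in _ = _ * X]adjE [X in _ = X * _]cj mulNr -mulrN opprB.
Qed.

(** If the form of K = j (S - T) were negative somewhere, K would have an approximate
eigenvalue mu < 0, and H = T + S an approximate eigenvalue lam on the approximate
eigenvectors of K for mu.  As 2 T = H + j K, the number (lam + j mu) / 2 would then
be a non-real point of the spectrum of T. *)
Lemma imaginary_part_ge0 T (S : {linear ell2 pi -> ell2 pi}) (j : R[i]) :
  contraction_op T -> contraction_op S -> is_adjoint T S ->
  T \o S = S \o T -> j * j = -1 -> Num.conj j = - j -> complex.Im j != 0 ->
  (forall z, spectrum T z -> complex.Im z = 0) ->
  forall u, 0 <= dot (j *: (S u - T u)) u.
Proof.
move=> Tc Sc adj TS jj cj imj real_spec u0.
rewrite leNgt; apply/negP => neg.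
pose K u := j *: (S u - T u).
pose H u := T u + S u.
have Klin : linear K.
  move=> a u v; rewrite /K (linearP T) (linearP S) /= [a *: (j *: _)]scalerA.
  rewrite (mulrC a) -scalerA -scalerDr.
  by congr (_ *: _); rewrite scalerBr opprD addrACA.
have Hlin : linear H.
  by move=> a u v; rewrite /H (linearP T) (linearP S) /= scalerDr addrACA.
have comm u : T (S u) = S (T u) by have := congr1 (@^~ u) TS.
have Ksym u v : dot (K u) v = dot u (K v).
  exact: imaginary_part_symmetric.
have adj' u v : inner (S u) v = inner u (T v).
  by rewrite inner_conj -adj -inner_conj.
have Hsym u v : dot (H u) v = dot u (H v).
  by rewrite /H dotDl dotDr /dot (adj u v) (adj' u v) addrC.
have Nj : normc j = 1.
  have : normc (j * j) = 1 by rewrite jj normcN normc1.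
  rewrite normcM -expr2 => /eqP; rewrite sqrp_eq1 ?normc_ge0//.
  by move/eqP.
have Kbd u : nrm (K u) <= 2 * nrm u.
  rewrite ell2_normZc Nj mul1r; apply: le_trans (ell2_normB _ _) _.
  by have := Tc u; have := Sc u; lra.
have Hbd u : nrm (H u) <= 2 * nrm u.
  apply: le_trans (ell2_normD _ _) _.
  by have := Tc u; have := Sc u; lra.
have u0_gt0 : 0 < nrm u0.
  rewrite lt_def ell2_norm_ge0 andbT; apply/eqP => z.
  move: neg; rewrite -/(K u0) -oppr_gt0 -dotNl.
  by have := dot_le (- K u0) u0; rewrite z mulr0; lra.
have zlin : linear (fun _ : ell2 pi => 0 : ell2 pi).
  by move=> a u v; rewrite scaler0 addr0.
have [||mu [apxK lowK]] := approx_eigenvectors Klin zlin Ksym Kbd.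
- by move=> u; rewrite /K (linear0 T) (linear0 S) subr0 scaler0.
- move=> e e0; exists u0; split => //.
  by rewrite ell2_norm0 mulr_ge0 ?ell2_norm_ge0// ltW.
have mu0 : mu < 0.
  have := lowK u0 erefl; rewrite -/(K u0) in neg.
  move=> /le_lt_trans => /(_ _ neg).
  by rewrite pmulr_llt0// exprn_gt0.
pose D u := K u - mu%:C *: u.
have Dlin : linear D.
  move=> a u v; rewrite /D Klin !scalerDr !scalerN !scalerA (mulrC _ a) opprD.
  by rewrite addrACA.
have DH u : D (H u) = H (D u).
  have HZ (c : R[i]) v : H (c *: v) = c *: H v.
    by rewrite /H !linearZ /= scalerDr.
  rewrite /D (linear_morphB Hlin) HZ; congr (_ - _).
  rewrite /K HZ; congr (_ *: _).
  rewrite (linear_morphB Hlin) /H.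
  by rewrite !linearD /= !comm addrC.
have [|lam [apx _]] := approx_eigenvectors Hlin Dlin Hsym Hbd DH.
  move=> e e0; have [u [up _ ue]] := apxK _ e0.
  by exists u.
pose z : R[i] := (2^-1 : R)%:C * (lam%:C + j * mu%:C).
have : spectrum T z.
  apply: approx_eigenvalue_spectrum => e e0.
  have [u [up Du Hu]] := apx _ e0.
  exists u => //.
  have -> : T u - z *: u = (2^-1 : R)%:C *:
      ((H u - lam%:C *: u) + j *: (K u - mu%:C *: u)).
    have -> : (H u - lam%:C *: u) + j *: (K u - mu%:C *: u) =
        (2 : R)%:C *: T u - (lam%:C + j * mu%:C) *: u.
      rewrite /K scalerBr !scalerA jj scaleN1r opprB scalerDl opprD.
      rewrite addrACA (_ : H u + (T u - S u) = T u *+ 2); last first.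
        by rewrite /H addrACA subrr addr0 -mulr2n.
      by rewrite (rmorph_nat (real_complex R) 2) scaler_nat.
    by rewrite scalerBr !scalerA -rmorphM mulVf ?pnatr_eq0// rmorph1 scale1r.
  rewrite ell2_normZ ger0_norm ?invr_ge0//.
  have := ell2_normD (H u - lam%:C *: u) (j *: (K u - mu%:C *: u)).
  rewrite ell2_normZc Nj mul1r -/(D u); lra.
move/real_spec.
have -> : complex.Im z = 2^-1 * (complex.Im j * mu).
  by rewrite /z; case: (j) => ? ? /=; ring.
move/eqP; rewrite !mulf_eq0 invr_eq0 pnatr_eq0/= (negbTE imj)/=.
by rewrite lt_eqF.
Qed.

(** |S u|^2 = (T S u, u) <= |S u| |u|. *)
Lemma adjoint_contraction T (S : {linear ell2 pi -> ell2 pi}) :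
  contraction_op T -> is_adjoint T S -> contraction_op S.
Proof.
move=> Tc adj u.
have [->|Su0] := eqVneq (nrm (S u)) 0; first exact: ell2_norm_ge0.
have Sup : 0 < nrm (S u) by rewrite lt_def Su0 ell2_norm_ge0.
rewrite -(ler_pM2l Sup) -expr2 -dot_self.
have -> : dot (S u) (S u) = dot (T (S u)) u by rewrite /dot adj.
by apply: le_trans (dot_le _ _) _; rewrite ler_wpM2r ?ell2_norm_ge0.
Qed.

(** The form of the imaginary part has both signs excluded, hence vanishes, and a
symmetric operator with zero quadratic form is zero. *)
Lemma normal_real_spectrum_symmetric T :
  contraction_op T -> normal_op T ->
  (forall z, spectrum T z -> complex.Im z = 0) ->
  forall u v, dot (T u) v = dot u (T v).
Proof.
move=> Tc [S adj TS] real_spec u v.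
have Sc := adjoint_contraction Tc adj.
pose K w := 'i%C *: (S w - T w).
have ii : 'i%C * 'i%C = -1 :> R[i] by rewrite -expr2 sqr_i.
have ci : Num.conj 'i%C = - 'i%C :> R[i].
  by apply/eqP; rewrite eq_complex/= oppr0 !eqxx.
have K0 w : dot (K w) w = 0.
  apply/eqP; rewrite eq_le; apply/andP; split; last first.
    by apply: (imaginary_part_ge0 Tc Sc adj TS ii ci) => //=; exact: oner_neq0.
  rewrite -oppr_ge0 -dotNl /K -scaleNr.
  apply: (imaginary_part_ge0 Tc Sc adj TS) => //=.
  - by rewrite mulrNN.
  - by rewrite rmorphN/= [in LHS]ci.
have KD w w' : K (w + w') = K w + K w'.
  by rewrite /K (linearD T) (linearD S) opprD addrACA scalerDr.
have K00 w w' : dot (K w) w' = 0.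
  have := K0 (w + w'); rewrite KD dotDl !dotDr !K0 add0r addr0.
  rewrite [dot (K w') w]dotC -[dot w _](imaginary_part_symmetric adj ci).
  by rewrite -/(K w); lra.
have Ku0 : nrm (S u - T u) = 0.
  have : nrm (K u) = 0 by apply/eqP; rewrite -sqrf_eq0 -dot_self K00.
  by rewrite ell2_normZc /= expr0n/= expr1n add0r sqrtr1 mul1r.
have STv w : `|dot (S u - T u) w| <= 0.
  rewrite ler_norml oppr0 -oppr_le0 -dotNr.
  by rewrite !(le_trans (dot_le _ _))// Ku0 mul0r.
have := STv v; rewrite normr_le0 dotBl subr_eq0 => /eqP <-.
by rewrite dotC [RHS]dotC /dot adj.
Qed.

Lemma spectrum_lower_bound T (a : R) :
  contraction_op T -> (forall u v, dot (T u) v = dot u (T v)) ->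
  (forall r : R, spectrum T r%:C -> a <= r) ->
  forall u, a * nrm u ^+ 2 <= dot (T u) u.
Proof.
move=> Tc Tsym spec u.
have [u0|un0] := eqVneq (nrm u) 0.
  rewrite u0 expr0n mulr0 -oppr_le0 -dotNr.
  by apply: le_trans (dot_le _ _) _; rewrite ell2_normN u0 mulr0.
have up : 0 < nrm u by rewrite lt_def un0 ell2_norm_ge0.
have zlin : linear (fun _ : ell2 pi => 0 : ell2 pi).
  by move=> c v w; rewrite scaler0 addr0.
have [|||l [apx low]] := approx_eigenvectors (linearP T) zlin Tsym (h := 1).
- by move=> v; rewrite mul1r; exact: Tc.
- by move=> v; rewrite linear0.
- move=> e e0; exists u; split => //.
  by rewrite ell2_norm0 mulr_ge0 ?ell2_norm_ge0// ltW.
apply: le_trans (low u erefl).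
rewrite ler_wpM2r ?sqr_ge0//; apply: spec.
apply: approx_eigenvalue_spectrum => e e0.
by have [v [v0 _ ve]] := apx _ e0; exists v.
Qed.

(** 2 (1 - A^2) = (1 - A) (1 + A) (1 - A) + (1 + A) (1 - A) (1 + A), a sum of two
nonnegative operators. *)
Lemma symmetric_contraction (A : ell2 pi -> ell2 pi) :
  linear A -> (forall u v, dot (A u) v = dot u (A v)) ->
  (forall u, `|dot (A u) u| <= nrm u ^+ 2) -> contraction_op A.
Proof.
move=> Alin Asym Ale u.
have AB := linear_morphB Alin; have AD := linear_morphD Alin.
have := Ale (u + A u); have := Ale (u - A u).
rewrite AB AD !ler_norml => /andP[h1 _] /andP[_ h2].
move: h1 h2; rewrite -!dot_self.
rewrite !(dotDl, dotDr, dotBl, dotBr, dotNl, dotNr).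
rewrite !(Asym (A u)) (dotC (A u) u) !dot_self => h1 h2.
rewrite -ler_sqr ?nnegrE ?ell2_norm_ge0//.
by lra.
Qed.

End NormalOperators.

(** * Chebyshev expansions *)

Section Chebyshev.
Variable K : fieldType.

(** The vector T_m(A) v, by the three-term recurrence.  The operator A is a plain
function on an arbitrary module: the same expansion is applied to operators and,
on the scalars, to multiplication by (z + 1/z) / 2. *)
Fixpoint cheb (V : lmodType K) (A : V -> V) (v : V) (m : nat) : V :=
  if m is m'.+1 then
    if m' is m''.+1 then 2%:R *: A (cheb A v m') - cheb A v m'' else A v
  else v.

(** A polynomial is used as the list of its coefficients in the Chebyshev basis, not
in the basis of monomials. *)
Definition cheb_comb (V : lmodType K) (A : V -> V) (v : V) (p : {poly K}) : V :=
  \sum_(m < size p) p`_m *: cheb A v m.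

(** Multiplication by the variable, read on Chebyshev coefficients:
X T_0 = T_1 and X T_m = (T_{m+1} + T_{m-1}) / 2. *)
Definition mul_by_X (p : {poly K}) : {poly K} :=
  \sum_(m < size p) p`_m *:
    (if val m is m'.+1 then 2%:R^-1 *: ('X^(m'.+2) + 'X^m') else 'X).

(** The Chebyshev coefficients of (1 - (s (1 - X))^k)^n. *)
Definition smoothed_poly (s : K) (k n : nat) : {poly K} :=
  iter n (fun p => p - iter k (fun q => s *: (q - mul_by_X q)) p) 1.

Section Combinations.
Context (V : lmodType K) (A : V -> V) (v : V).
Hypothesis two_unit : 2%:R != 0 :> K.
Hypothesis Alin : linear A.
Local Notation t := (cheb A v).
Local Notation comb := (cheb_comb A v).

Lemma cheb_comb_widen (p : {poly K}) D : (size p <= D)%N ->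
  comb p = \sum_(m < D) p`_m *: t m.
Proof.
move=> pD; rewrite /cheb_comb (big_ord_widen D (fun m => p`_m *: t m))//.
rewrite big_mkcond; apply: eq_bigr => m _.
by case: ltnP => // /(nth_default 0) ->; rewrite scale0r.
Qed.

Lemma cheb_comb_linear : linear comb.
Proof.
move=> a p q; pose D := maxn (size (a *: p + q)) (maxn (size p) (size q)).
rewrite !(@cheb_comb_widen _ D) ?leq_max ?leqnn ?orbT//.
rewrite scaler_sumr -big_split; apply: eq_bigr => m _ /=.
by rewrite coefD coefZ scalerDl scalerA.
Qed.

HB.instance Definition _ := GRing.isLinear.Build K {poly K} V *:%R comb
  cheb_comb_linear.

Lemma cheb_comb_Xn m : comb 'X^m = t m.
Proof.
rewrite /cheb_comb size_polyXn big_ord_recr /= big1 ?add0r.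
  by rewrite coefXn eqxx scale1r.
by move=> i _; rewrite coefXn ltn_eqF// scale0r.
Qed.

Lemma cheb_comb_mul_by_X p : comb (mul_by_X p) = A (comb p).
Proof.
have -> : A (comb p) = \sum_(m < size p) p`_m *: A (t m).
  rewrite /cheb_comb; elim/big_rec2 : _ => [|m y1 y2 _ <-].
    exact: linear_morph0.
  by rewrite Alin.
rewrite linear_sum; apply: eq_bigr => -[[|m] mp] _; rewrite linearZ /=.
  by rewrite -[X in comb X]expr1 cheb_comb_Xn.
rewrite linearZ linearD /= !cheb_comb_Xn /=.
by congr (_ *: _); rewrite subrK scalerA mulVf// scale1r.
Qed.

Lemma cheb_comb_smoothed (s : K) (k n : nat) :
  comb (smoothed_poly s k n) =
  iter n (fun w => w - iter k (fun u => s *: (u - A u)) w) v.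
Proof.
have step q w : comb q = w ->
    comb (iter k (fun q => s *: (q - mul_by_X q)) q) =
    iter k (fun u => s *: (u - A u)) w.
  by move=> qw; elim: k => //= j IH; rewrite linearZ linearB /= cheb_comb_mul_by_X IH.
elim: n => [|n IH] /=; first by rewrite -(expr0 'X) cheb_comb_Xn.
by rewrite linearB /= (step _ _ IH) IH.
Qed.

End Combinations.
End Chebyshev.

Section ChebyshevContraction.
Context {R : realType} {X : choiceType} (pi : X -> {posnum R}).
Implicit Types (u v w : ell2 pi).
Local Notation nrm := ell2_norm.

(** This is 1 - T_m^2 = (1 - X^2) U_{m-1}^2 on vectors.  The induction carries
u = U_{m-1}(A) v along with T_m(A) v: the pair evolves by
T_{m+1} = X T_m - (1 - X^2) U_{m-1} and U_m = X U_{m-1} + T_m, and the energy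
|T_m v|^2 + |u|^2 - |A u|^2 is conserved. *)
Lemma cheb_contraction (A : ell2 pi -> ell2 pi) v m :
  linear A -> (forall u w, dot (A u) w = dot u (A w)) -> contraction_op A ->
  nrm (cheb A v m) <= nrm v.
Proof.
move=> Alin Asym Ac.
have AB := linear_morphB Alin; have AD := linear_morphD Alin.
have A0 := linear_morph0 Alin.
have dot0 a : dot 0 a = 0 by have := dotBl 0 0 a; rewrite !subrr.
suff [u [_ E]] : exists u, cheb A v m.+1 = A (cheb A v m) - (u - A (A u)) /\
    nrm (cheb A v m) ^+ 2 + nrm u ^+ 2 - nrm (A u) ^+ 2 = nrm v ^+ 2.
  rewrite -ler_sqr ?nnegrE ?ell2_norm_ge0// -E -addrA lerDl subr_ge0.
  by rewrite ler_sqr ?nnegrE ?ell2_norm_ge0.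
elim: m => [|m [u [tS E]]].
  exists 0 => /=; rewrite !A0 !subr0; split=> //.
  by rewrite -(dot_self 0) dot0 addr0 subr0.
exists (A u + cheb A v m); split.
  rewrite [LHS]/= -/(cheb A v m.+1) scaler_nat mulr2n -addrA; congr (_ + _).
  rewrite tS !AB !AD.
  have arrange a b c t : a - (b - c) - t = - (b + t - (c + a)) :> ell2 pi.
    by rewrite !opprB opprD !addrA (addrC c a).
  exact: arrange.
rewrite -E tS -!dot_self !AD.
rewrite !(dotDl, dotDr, dotBl, dotBr, dotNl, dotNr).
set t := cheb A v m.
have e1 : dot (A t) u = dot t (A u) by exact: Asym.
have e2 : dot u (A (A u)) = dot (A u) (A u) by rewrite -Asym.
rewrite (dotC u (A t)) e1 (dotC (A (A u)) u) e2 (dotC (A (A u)) (A t)).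
rewrite (dotC (A u) t).
by ring.
Qed.

End ChebyshevContraction.

Section ScalarChebyshev.
Variable K : fieldType.
Hypothesis two_unit : 2%:R != 0 :> K.

Lemma cheb_scalar (z : K) m : z != 0 ->
  cheb (fun y : K^o => (z + z^-1) / 2%:R * y) 1 m = (z ^+ m + z^-1 ^+ m) / 2%:R.
Proof.
move=> z0.
have [] : cheb (fun y : K^o => (z + z^-1) / 2%:R * y) 1 m =
       (z ^+ m + z^-1 ^+ m) / 2%:R /\
     cheb (fun y : K^o => (z + z^-1) / 2%:R * y) 1 m.+1 =
       (z ^+ m.+1 + z^-1 ^+ m.+1) / 2%:R.
  elim: m => [|m [IH1 IH2]].
    by rewrite /= mulr1 !expr0 !expr1; split => //; rewrite -mulr2n divff.
  split => //.
  rewrite [LHS]/= -/(cheb _ _ m.+1) IH1 IH2 /GRing.scale/= !exprS.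
  move: (z ^+ m) (z^-1 ^+ m) => a b.
  by field; rewrite z0 two_unit.
by [].
Qed.

Lemma smoothed_poly_scalar (z s : K) k n : z != 0 ->
  \sum_(m < size (smoothed_poly s k n)) (smoothed_poly s k n)`_m *
     ((z ^+ m + z^-1 ^+ m) / 2%:R) =
  (1 - (s * (1 - (z + z^-1) / 2%:R)) ^+ k) ^+ n.
Proof.
move=> z0; set x := (z + z^-1) / 2%:R.
pose Ax : K^o -> K^o := fun y => x * y.
have xlin : linear Ax.
  by move=> a u v; rewrite /Ax mulrDr /GRing.scale/= mulrCA.
have := cheb_comb_smoothed (1 : K^o) two_unit xlin s k n.
rewrite /cheb_comb => h.
transitivity (\sum_(m < size (smoothed_poly s k n)) (smoothed_poly s k n)`_m *:
     cheb Ax 1 m).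
  by apply: eq_bigr => m _; rewrite cheb_scalar.
rewrite h.
have iterk (w : K^o) : iter k (fun u : K^o => s *: (u - Ax u)) w =
    (s * (1 - x)) ^+ k * w.
  elim: k {h} => [|j IH] /=; first by rewrite mul1r.
  by rewrite IH /Ax /GRing.scale/= exprS; ring.
elim: n {h} => [|n IH] //=.
by rewrite iterk IH exprS; ring.
Qed.

End ScalarChebyshev.

(** * Coefficients from samples on a circle *)

Section FourierCoefficients.

Lemma sum_roots_of_unity (K : fieldType) (q : K) N : q ^+ N = 1 ->
  \sum_(j < N) q ^+ j = if q == 1 then N%:R else 0.
Proof.
move=> qN; case: eqP => [->|/eqP q1].
  rewrite (eq_bigr (fun=> 1)) => [|j _]; last by rewrite expr1n.
  by rewrite sumr_const card_ord.
have := subrX1 q N; rewrite qN subrr => /esym/eqP.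
by rewrite mulf_eq0 subr_eq0 (negbTE q1) => /eqP.
Qed.

(** Orthogonality of the characters of the N-th roots of unity.  The bound
2 size p <= N excludes aliasing between the exponents m, - m and l; the exponents
m and - m coincide at 0, which explains the different constant for l = 0. *)
Lemma fourier_coefficient (K : fieldType) (w r : K) (p : {poly K}) N l :
  2%:R != 0 :> K -> N.-primitive_root w -> r != 0 ->
  (l < size p)%N -> (2 * size p <= N)%N ->
  \sum_(j < N) (\sum_(m < size p) p`_m *
      (((r * w ^+ j) ^+ m + (r * w ^+ j)^-1 ^+ m) / 2%:R)) * w^-1 ^+ (j * l) =
  N%:R * (p`_l * r ^+ l / (if l == 0%N then 1 else 2%:R)).
Proof.
move=> two_unit prim r0 lp pN.
have N0 : (0 < N)%N by lia.
have wN := prim_expr_order prim.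
have w0 : w != 0.
  apply/eqP => w0; move/eqP: wN; rewrite w0 expr0n gtn_eqF//=.
  by rewrite eq_sym oner_eq0.
have wVN : w^-1 ^+ N = 1 by rewrite exprVn wN invr1.
under eq_bigr do rewrite mulr_suml.
rewrite exchange_big /=.
transitivity (\sum_(m < size p) p`_m / 2%:R *
   (r ^+ m * (if val m == l then N%:R else 0) +
    r^-1 ^+ m * (if (val m == 0%N) && (l == 0%N) then N%:R else 0))).
  apply: eq_bigr => m _.
  have mp := ltn_ord m.
  have mlN : (m + l < N)%N.
    by apply: leq_trans pN; rewrite mul2n -addnn -addnS leq_add// ltnW.
  have mN : (m < N)%N by apply: leq_ltn_trans mlN; exact: leq_addr.
  have lN : (l < N)%N by apply: leq_ltn_trans mlN; exact: leq_addl.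
  have -> : (if val m == l then N%:R else 0) =
      \sum_(j < N) (w ^+ m * w^-1 ^+ l) ^+ j.
    rewrite sum_roots_of_unity; last first.
      by rewrite exprMn -!exprM !(mulnC _ N) !exprM wN wVN !expr1n mulr1.
    rewrite exprVn -[_ == 1](inj_eq (mulIf (expf_neq0 l w0))) mulfVK ?expf_neq0//.
    by rewrite mul1r (eq_prim_root_expr prim) !modn_small.
  have -> : (if (val m == 0%N) && (l == 0%N) then N%:R else 0) =
      \sum_(j < N) (w^-1 ^+ m * w^-1 ^+ l) ^+ j.
    rewrite -exprD sum_roots_of_unity; last first.
      by rewrite -exprM mulnC exprM wVN expr1n.
    rewrite exprVn invr_eq1 -[1 in RHS](expr0 w) (eq_prim_root_expr prim).
    by rewrite mod0n modn_small ?addn_eq0.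
  rewrite !mulr_sumr -big_split mulr_sumr; apply: eq_bigr => j _ /=.
  rewrite exprMn invfM !exprMn -!exprM !(mulnC j).
  by rewrite -!exprVn -exprM (mulnC j m); ring.
rewrite (bigD1 (Ordinal lp))//= eqxx big1 ?addr0 => [|m /eqP ml]; last first.
  case: ifPn => [/eqP ml'|ml']; first by case: ml; apply: val_inj.
  case: ifPn => [/andP[/eqP m0 /eqP l0]|_]; last by rewrite !mulr0 addr0 mulr0.
  by case/eqP: ml'; rewrite m0 l0.
rewrite andbb; case: eqP => [->|_].
  by rewrite !expr0; field; rewrite oner_neq0 two_unit.
by rewrite mulr0 addr0; ring.
Qed.

Lemma fourier_coefficient_bound (R : realType) (w : R[i]) (r : R)
    (p : {poly R[i]}) N l :
  N.-primitive_root w -> normc w = 1 -> 0 < r ->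
  (l < size p)%N -> (2 * size p <= N)%N ->
  normc p`_l <= 2 * r^-1 ^+ l * (N%:R^-1 * \sum_(j < N)
    normc (\sum_(m < size p) p`_m *
      (((r%:C * w ^+ j) ^+ m + (r%:C * w ^+ j)^-1 ^+ m) / 2%:R))).
Proof.
move=> prim w1 r0 lp pN.
have N0 : 0 < N%:R :> R by rewrite ltr0n; lia.
have rC0 : r%:C != 0 by rewrite -(rmorph0 (real_complex R)) (inj_eq (@complexI _)) gt_eqF.
have two0 : 2%:R != 0 :> R[i] by rewrite pnatr_eq0.
have := fourier_coefficient two0 prim rC0 lp pN.
move/(congr1 (@normc R)).
set q : R[i] := if _ then _ else _.
rewrite normcM normcM normcM normcX normcV.
have -> : normc (N%:R : R[i]) = N%:R.
  by rewrite -(rmorph_nat (real_complex R)) normc_real ger0_norm// ler0n.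
have -> : normc r%:C = r by rewrite normc_real gtr0_norm.
move=> E.
have q2 : normc q <= 2.
  rewrite /q; case: ifP => _; first by rewrite normc1 ler1n.
  by rewrite -(rmorph_nat (real_complex R)) normc_real ger0_norm// ler0n.
have q0 : 0 < normc q.
  rewrite lt_def normc_ge0 andbT; apply/eqP => /eq0_normc; rewrite /q.
  by case: ifP => _ /eqP; rewrite ?oner_eq0 ?(negbTE two0).
set S := \sum_(j < N) _.
have ES : N%:R * (normc p`_l * r ^+ l / normc q) <= S.
  rewrite -E; apply: le_trans (normc_sum _ _ _) _.
  apply: ler_sum => j _; rewrite normcM normcX normcV w1 invr1 expr1n mulr1.
  exact: lexx.
rewrite exprVn mulrAC ler_pdivlMr ?exprn_gt0//.
have : normc p`_l * r ^+ l / normc q <= N%:R^-1 * S.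
  by rewrite -(ler_pM2l N0) (mulVKf (lt0r_neq0 N0)).
rewrite ler_pdivrMr// => /le_trans; apply.
rewrite mulrC ler_wpM2r// mulr_ge0 ?invr_ge0 ?ler0n//.
by apply: sumr_ge0 => j _; exact: normc_ge0.
Qed.

End FourierCoefficients.

(** * Roots of unity and Gaussian averages *)

Section RootsOfUnity.
Context {R : realType}.
Implicit Types (x y : R).

Definition expi x : R[i] := cos x +i* sin x.

Lemma expiD x y : expi (x + y) = expi x * expi y.
Proof.
rewrite /expi cosD sinD; apply/eqP; rewrite eq_complex/= !eqxx /=.
by rewrite addrC (mulrC (sin x)) eqxx.
Qed.

Lemma expiX x n : expi x ^+ n = expi (n%:R * x).
Proof.
elim: n => [|n IH]; first by rewrite mul0r expr0 /expi cos0 sin0.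
by rewrite exprS IH -expiD -natr1 mulrDl mul1r addrC.
Qed.

Lemma normc_expi x : normc (expi x) = 1.
Proof. by rewrite /= cos2Dsin2 sqrtr1. Qed.

Lemma one_minus_cos x : 1 - cos x = 2 * sin (x / 2) ^+ 2.
Proof.
rewrite {1}(_ : x = (x / 2) *+ 2); last by rewrite -mulr_natr divfK// pnatr_eq0.
by rewrite cos_mulr2n cos2sin2 mulr2n; ring.
Qed.

Definition unity_angle N : R := 2 * pi / N%:R.

Lemma unity_angle_half N j : j%:R * unity_angle N / 2 = pi * (j%:R / N%:R).
Proof. by rewrite /unity_angle; move: (N%:R^-1) => i; field. Qed.

Lemma expi_primitive_root N : (0 < N)%N ->
  N.-primitive_root (expi (unity_angle N)).
Proof.
move=> N0; rewrite /primitive_root_of_unity N0/=; apply/forallP => i.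
rewrite unity_rootE expiX; apply/eqP.
have Np : 0 < N%:R :> R by rewrite ltr0n.
case: (eqVneq i.+1 N) => [->|iN].
  rewrite /unity_angle mulrC divfK ?lt0r_neq0//.
  by rewrite /expi mulrC mulr_natr cos2pi sin2pi eqxx.
apply/negbTE/eqP => -[c1 _].
have := one_minus_cos (i.+1%:R * unity_angle N).
rewrite c1 subrr unity_angle_half => /esym/eqP.
rewrite mulf_eq0 pnatr_eq0 /= sqrf_eq0 => /eqP s0.
suff : 0 < sin (pi * (i.+1%:R / N%:R) : R) by rewrite s0 ltxx.
apply: sin_gt0_pi; rewrite mulr_gt0 ?pi_gt0 ?divr_gt0 ?ltr0n//=.
rewrite -[X in _ < X]mulr1 ltr_pM2l ?pi_gt0// ltr_pdivrMr// mul1r ltr_nat.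
by rewrite ltn_neqAle iN /=; exact: ltn_ord.
Qed.

Lemma sin_ge_quarter x : 0 <= x <= pi / 2 -> x / 4 <= sin x.
Proof.
move=> /andP[x0 xpi].
have ph := @pihalf_lt2 R.
have half_sin y : 0 <= y <= pi / 4 -> y / 2 <= sin y.
  move=> /andP[y0 ypi].
  have [->|yn0] := eqVneq y 0; first by rewrite mul0r sin0.
  have yp : 0 < y by rewrite lt_def yn0.
  have [|c cy] := @MVT R sin cos 0 y yp.
    by apply: continuous_subspaceT => z; exact: continuous_sin.
  rewrite sin0 !subr0 => ->; rewrite mulrC ler_wpM2r//.
  move: cy; rewrite in_itv/= => /andP[c0 cy].
  have cq : cos (pi / 4) = sin (pi / 4) :> R.
    rewrite -cosBpihalf -cosN; congr cos; lra.
  have cq2 := cos2Dsin2 (pi / 4 : R); rewrite -cq in cq2.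
  have cq0 : 0 < cos (pi / 4 : R).
    by apply: cos_gt0_pihalf; have := @pi_gt0 R; lra.
  have : cos (pi / 4) <= cos c.
    by rewrite le_eqVlt ltr_cos ?in_itv/=; have := @pi_gt0 R; lra.
  by nra.
have [xq|xq] := leP x (pi / 4).
  by have := half_sin x; rewrite x0 xq => /(_ isT); lra.
have p4 : pi / 4 / 2 <= sin (pi / 4) :> R.
  by apply: half_sin; rewrite lexx andbT; have := @pi_ge0 R; lra.
have := @pi_ge2 R; have : sin (pi / 4) <= sin x.
  rewrite le_eqVlt ltr_sin ?xq ?orbT// in_itv/=; lra.
have := @pi_ge0 R; lra.
Qed.

(** The minimum is the distance on the circle from the j-th sample point to 1, in
turns. *)
Lemma one_minus_cos_ge N j : (j < N)%N ->
  Num.min (j%:R / N%:R) ((N - j)%:R / N%:R) ^+ 2 / 2 <=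
  1 - cos (j%:R * unity_angle N).
Proof.
move=> jN; set f := Num.min _ _; rewrite one_minus_cos unity_angle_half.
have N0 : 0 < N%:R :> R by rewrite ltr0n (leq_ltn_trans _ jN).
have pi2 := @pi_ge2 R.
have compl : (N - j)%:R / N%:R = 1 - j%:R / N%:R :> R.
  by rewrite natrB 1?ltnW// mulrBl divff ?lt0r_neq0.
have f0 : 0 <= f by rewrite /f le_min !divr_ge0// ler0n.
have sinf : sin (pi * (j%:R / N%:R)) = sin (pi * f).
  rewrite /f; case: leP => // _.
  rewrite compl mulrBr mulr1 sinB sinpi cospi mul0r sub0r mulN1r.
  by rewrite opprK.
rewrite sinf.
have fhalf : f <= 2^-1 by rewrite /f compl ge_min; case: leP => //=; lra.
have h : f / 2 <= sin (pi * f).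
  apply: (@le_trans _ _ (pi * f / 4)); first by nra.
  by apply: sin_ge_quarter; apply/andP; split; nra.
have : (f / 2) ^+ 2 <= sin (pi * f) ^+ 2 by rewrite ler_sqr ?nnegrE; lra.
by rewrite expr_div_n; lra.
Qed.

Lemma geometric_le (q : R) N : 0 <= q -> q < 1 ->
  \sum_(j < N) q ^+ j <= (1 - q)^-1.
Proof.
move=> q0 q1; have d0 : 0 < 1 - q by rewrite subr_gt0.
rewrite -(ler_pM2l d0) divff ?lt0r_neq0// -opprB mulNr -subrX1.
by have := exprn_ge0 N q0; lra.
Qed.

Lemma inv_one_minus_exp y : 0 < y -> (1 - expR (- y))^-1 <= 1 + y^-1.
Proof.
move=> y0; have e := expR_ge1Dx y.
have : expR (- y) <= (1 + y)^-1.
  by rewrite expRN lef_pV2 ?posrE ?expR_gt0 ?addr_gt0.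
set q := expR (- y) => qy.
have y1 : 0 < 1 + y by rewrite addr_gt0.
have -> : 1 + y^-1 = (1 - (1 + y)^-1)^-1.
  by field; rewrite (lt0r_neq0 y1) /= addrAC subrr add0r lt0r_neq0.
have : 0 < 1 - (1 + y)^-1 by rewrite subr_gt0 invf_lt1//; lra.
by move=> ?; rewrite lef_pV2 ?posrE; lra.
Qed.

Lemma expR_power_le (k : nat) (c w : R) : (1 <= k)%N -> 0 < c -> 0 <= w ->
  expR (- c * w ^+ (2 * k)) <= expR (1 + c^-1) * expR (- w).
Proof.
move=> k1 c0 w0; rewrite -expRD ler_expR.
have ci : 0 < c^-1 by rewrite invr_gt0.
have [w1|w1] := leP w (1 + c^-1).
  have : 0 <= c * w ^+ (2 * k) by rewrite mulr_ge0 ?exprn_ge0// ltW.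
  by rewrite mulNr; lra.
have : c * w ^+ 2 <= c * w ^+ (2 * k).
  by rewrite ler_wpM2l ?(ltW c0)// ler_weXn2l; [|lra|lia].
have cc : c * c^-1 = 1 by rewrite divff// lt0r_neq0.
rewrite mulNr => h.
have : 1 <= c * w by nra.
by nra.
Qed.

(** A Riemann sum of the integral of exp(- c nu^(2k) (1 - cos theta)^k), which is of
order 1 / nu because 1 - cos theta is comparable to the square of the distance
of theta to 0.  Bounding the exponential by exp(- nu f), with f that distance,
reduces it to geometric series, one for each end of the interval. *)
Lemma gaussian_average (k : nat) (c : R) : (1 <= k)%N -> 0 < c ->
  exists2 B : R, 0 < B & forall (nu : R) N, 0 < nu -> nu <= N%:R ->
  N%:R^-1 * \sum_(j < N) expR (- c * (nu ^+ (2 * k) *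
     (1 - cos (j%:R * unity_angle N)) ^+ k)) <= B / nu.
Proof.
move=> k1 c0; pose c2 := c / 2 ^+ k.
have c20 : 0 < c2 by rewrite divr_gt0// exprn_gt0.
pose C := expR (1 + c2^-1).
have C0 : 0 < C by exact: expR_gt0.
exists (4 * C) => [|nu N nu0 nuN]; first by rewrite mulr_gt0.
have Np : 0 < N%:R :> R by exact: lt_le_trans nu0 nuN.
pose q := expR (- (nu / N%:R)).
have q0 : 0 <= q by exact: expR_ge0.
have y0 : 0 < nu / N%:R by rewrite divr_gt0.
have q1 : q < 1 by rewrite expR_lt1 oppr_lt0.
have term j : (j < N)%N ->
    expR (- c * (nu ^+ (2 * k) * (1 - cos (j%:R * unity_angle N)) ^+ k)) <=
    C * (q ^+ j + q ^+ (N - j)).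
  move=> jN; have := one_minus_cos_ge jN; set f := Num.min _ _ => fle.
  have f0 : 0 <= f by rewrite /f le_min !divr_ge0// ler0n.
  apply: (@le_trans _ _ (expR (- c2 * (nu * f) ^+ (2 * k)))).
    rewrite ler_expR !mulNr lerN2 /c2.
    have -> : c / 2 ^+ k * (nu * f) ^+ (2 * k) =
        c * (nu ^+ (2 * k) * (f ^+ 2 / 2) ^+ k).
      by rewrite exprMn expr_div_n -exprM; ring.
    rewrite ler_wpM2l ?(ltW c0)// ler_wpM2l ?exprn_ge0 ?(ltW nu0)//.
    have nn : 0 <= f ^+ 2 / 2 by rewrite divr_ge0 ?sqr_ge0.
    by rewrite lerXn2r ?nnegrE// (le_trans nn).
  apply: le_trans (expR_power_le k1 c20 _) _; first by rewrite mulr_ge0// ltW.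
  rewrite ler_wpM2l ?(ltW C0)//.
  have E i : expR (- (nu * (i%:R / N%:R))) = q ^+ i.
    by rewrite /q -expRM_natl; congr expR; ring.
  rewrite /f; case: (leP (j%:R / N%:R) ((N - j)%:R / N%:R)) => _.
    by rewrite E lerDl exprn_ge0.
  by rewrite E lerDr exprn_ge0.
have S1 : \sum_(j < N) q ^+ j <= (1 - q)^-1 by exact: geometric_le.
have S2 : \sum_(j < N) q ^+ (N - j) <= (1 - q)^-1.
  rewrite (reindex_inj rev_ord_inj)/=.
  apply: le_trans (geometric_le N q0 q1); apply: ler_sum => j _.
  by rewrite subKn// exprS ler_piMl ?exprn_ge0// ltW.
have S3 : (1 - q)^-1 <= 1 + N%:R / nu.
  by have := inv_one_minus_exp y0; rewrite invf_div.
have : \sum_(j < N) expR (- c * (nu ^+ (2 * k) *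
     (1 - cos (j%:R * unity_angle N)) ^+ k)) <= 2 * C * (1 + N%:R / nu).
  apply: (@le_trans _ _ (\sum_(j < N) C * (q ^+ j + q ^+ (N - j)))).
    by apply: ler_sum => j _; apply: term.
  rewrite -mulr_sumr big_split /=; nra.
rewrite -(ler_pM2l (x := N%:R^-1)) ?invr_gt0// => /le_trans; apply.
have -> : N%:R^-1 * (2 * C * (1 + N%:R / nu)) = 2 * C * (N%:R^-1 + nu^-1).
  by field; rewrite !lt0r_neq0.
have : N%:R^-1 <= nu^-1 by rewrite lef_pV2.
by nra.
Qed.

End RootsOfUnity.

(** * The symbol off the unit circle *)

Section SymbolBound.
Context {R : realType}.

(** For h <= d t with d small, (t + h)^m <= (1 + d)^m t^m; otherwise t is at most
h / d and the second term absorbs everything. *)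
Lemma power_split (m : nat) (e : R) : 0 < e ->
  exists2 C : R, 0 < C & forall t h : R, 0 <= t -> 0 <= h ->
    (t + h) ^+ m <= (1 + e) * t ^+ m + C * h ^+ m.
Proof.
move=> e0; (* small enough for (1 + d)^m <= 1 + 3^m d <= 1 + e *)
pose d : R := Num.min 1 (e / 3 ^+ m).
have d0 : 0 < d by rewrite lt_min ltr01 divr_gt0// exprn_gt0.
have d1 : d <= 1 by rewrite ge_min lexx.
have bern j : (1 + d) ^+ j <= 1 + 3 ^+ j * d.
  elim: j => [|j IH]; first by rewrite !expr0; lra.
  rewrite !exprS; apply: le_trans (ler_wpM2l _ IH) _; first lra.
  have : 1 <= 3 ^+ j :> R by rewrite exprn_ege1// ler1n.
  set x := 3 ^+ j => x1.
  have : x * d * d <= x * d by rewrite ler_piMr// mulr_ge0//; lra.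
  by nra.
have de : (1 + d) ^+ m <= 1 + e.
  apply: le_trans (bern m) _; rewrite lerD2l mulrC -ler_pdivlMr ?exprn_gt0//.
  by rewrite ge_min lexx orbT.
exists ((d^-1 + 1) ^+ m) => [|t h t0 h0].
  by rewrite exprn_gt0// addr_gt0 ?invr_gt0.
have [hd|hd] := leP h (d * t).
  apply: (@le_trans _ _ (((1 + d) * t) ^+ m)).
    by rewrite lerXn2r ?nnegrE ?addr_ge0 ?mulr_ge0 ?(ltW d0)//; lra.
  rewrite exprMn; apply: (@le_trans _ _ ((1 + e) * t ^+ m)).
    by rewrite ler_wpM2r ?exprn_ge0.
  by rewrite lerDl mulr_ge0 ?exprn_ge0 ?addr_ge0 ?invr_ge0 ?(ltW d0).
apply: (@le_trans _ _ (((d^-1 + 1) * h) ^+ m)).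
  have th : t <= d^-1 * h by rewrite mulrC ler_pdivlMr// mulrC ltW.
  rewrite lerXn2r ?nnegrE ?addr_ge0 ?mulr_ge0 ?addr_ge0 ?invr_ge0 ?(ltW d0)//.
  by lra.
by rewrite exprMn lerDr mulr_ge0 ?exprn_ge0// addr_ge0// ltW.
Qed.

Lemma power_perturbation (s : R) (e : R[i]) k : 0 <= s ->
  normc ((s%:C + e) ^+ k - (s ^+ k)%:C) <= (s + normc e) ^+ k - s ^+ k.
Proof.
move=> s0; have ne := normc_ge0 e.
elim: k => [|k IH]; first by rewrite !expr0 !subrr normc0.
have -> : (s%:C + e) ^+ k.+1 - (s ^+ k.+1)%:C =
    (s%:C + e) * ((s%:C + e) ^+ k - (s ^+ k)%:C) + e * (s ^+ k)%:C.
  by rewrite !exprS rmorphM /=; ring.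
apply: le_trans (le_normcD _ _) _; rewrite !normcM normc_real.
rewrite (ger0_norm (exprn_ge0 k s0)).
have se : normc (s%:C + e) <= s + normc e.
  by apply: le_trans (le_normcD _ _) _; rewrite normc_real ger0_norm.
have := ler_pM (normc_ge0 _) (normc_ge0 _) se IH.
by rewrite !exprS; lra.
Qed.

(** At h = 0 the number s0 (1 - X) is s0 (1 - cos theta), in the interval [0, 2 s0],
where |1 - x^k| <= 1 - c1 x^k since (2 s0)^k < 2.  Moving off the circle perturbs
1 - cos theta = t^2 by at most h^2 + 2 t h, so the k-th power by at most
(t + h)^(2k) - t^(2k), of which [power_split] puts a small multiple of t^(2k) on
the gain and the rest in C h^(2k). *)
Lemma symbol_bound (k : nat) (s0 : R) : 0 < s0 -> (2 * s0) ^+ k < 2 ->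
  exists c C : R, [/\ 0 < c, 0 < C & forall (h th : R) (z : R[i]),
   0 <= h -> z = (1 + h)%:C * expi th ->
   normc (1 - (s0%:C * (1 - (z + z^-1) / 2%:R)) ^+ k) <=
   expR (- c * (1 - cos th) ^+ k + C * h ^+ (2 * k))].
Proof.
move=> s00 k2; set K := (2 * s0) ^+ k in k2.
have K0 : 0 < K by rewrite exprn_gt0// mulr_gt0.
(* the largest x is K, and K - 1 <= 1 - c1 K amounts to (2 - K)^2 >= 0 *)
pose c1 := (2 - K) / 2.
have c10 : 0 < c1 by rewrite /c1; lra.
have s0k : 0 < s0 ^+ k by rewrite exprn_gt0.
have [C0 C00 split_pow] := power_split (2 * k) (divr_gt0 c10 (ltr0n R 2)).
exists (c1 / 2 * s0 ^+ k), (s0 ^+ k * C0); split.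
- by rewrite mulr_gt0// divr_gt0.
- by rewrite mulr_gt0.
move=> h th z h0 zE.
set s := 1 - cos th.
have s_ge0 : 0 <= s by rewrite subr_ge0 cos_le1.
have s_le2 : s <= 2 by have := cos_geN1 th; rewrite /s; lra.
have h1 : 0 < 1 + h by lra.
(* cosh and sinh of ln (1 + h) *)
pose Ch := ((1 + h) + (1 + h)^-1) / 2; pose Sh := ((1 + h) - (1 + h)^-1) / 2.
pose e : R[i] := ((1 - Ch) * cos th) +i* (- (Sh * sin th)).
have xE : 1 - (z + z^-1) / 2%:R = s%:C + e.
  have zV : z^-1 = ((1 + h)^-1)%:C * (cos th -i* sin th).
    rewrite zE invfM fmorphV; congr (_ * _).
    have := normc_expi th; have := mul_conj_normc (expi th) => + n1.
    rewrite n1 expr1n rmorph1 => E.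
    by rewrite -[LHS]mulr1 -E mulKf//; apply/eqP => z0; move: E;
       rewrite z0 mul0r => /eqP; rewrite eq_sym oner_eq0.
  rewrite zV zE -(rmorph_nat (real_complex R) 2) -fmorphV /e /Ch /Sh /s.
  apply/eqP; rewrite eq_complex /= !(mul0r, mulr0, subr0, addr0, add0r).
  by apply/andP; split; apply/eqP; ring.
have inv_le : 1 - h <= (1 + h)^-1 <= 1.
  by rewrite invf_le1// -[leRHS]mul1r ler_pdivlMr//; apply/andP; split; nra.
have invE : (1 + h) * (1 + h)^-1 = 1 by rewrite divff ?lt0r_neq0.
have Chb : `|1 - Ch| <= h ^+ 2.
  rewrite /Ch ler_norml; move: ((1 + h)^-1) inv_le invE => y /andP[y1 y2] yE.
  by apply/andP; split; nra.
have Shb : `|Sh| <= h.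
  rewrite /Sh ler_norml; move: ((1 + h)^-1) inv_le => y /andP[y1 y2].
  by apply/andP; split; nra.
pose t := Num.sqrt s.
have t0 : 0 <= t := sqrtr_ge0 s.
have tt : t ^+ 2 = s by rewrite sqr_sqrtr.
have sinb : `|sin th| <= 2 * t.
  rewrite -ler_sqr ?nnegrE ?mulr_ge0// real_normK ?num_real// sin2cos2 exprMn tt.
  by have := cos_geN1 th; rewrite /s in s_ge0 *; nra.
have eb : normc e <= h ^+ 2 + 2 * t * h.
  have -> : e = ((1 - Ch) * cos th)%:C + 'i%C * (- (Sh * sin th))%:C.
    by rewrite [LHS]complexE.
  apply: le_trans (le_normcD _ _) _; rewrite normcM !normc_real.
  have -> : normc ('i%C : R[i]) = 1 by rewrite /= expr0n expr1n add0r sqrtr1.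
  rewrite mul1r normrN (normrM (1 - Ch)) (normrM Sh) lerD//.
    by rewrite -[leRHS]mulr1 ler_pM// cos_max.
  by rewrite mulrC ler_pM.
have seb : s + normc e <= (t + h) ^+ 2 by rewrite sqrrD tt; lra.
rewrite xE exprMn; clearbody s.
have -> : 1 - s0%:C ^+ k * (s%:C + e) ^+ k =
    (1 - (s0 ^+ k * s ^+ k))%:C - (s0 ^+ k)%:C * ((s%:C + e) ^+ k - (s ^+ k)%:C).
  rewrite (rmorphB (real_complex R)) (rmorphM (real_complex R)) rmorph1.
  by rewrite !(rmorphXn (real_complex R)) /=; ring.
apply: le_trans (le_normcD _ _) _; rewrite normcN normcM !normc_real.
rewrite (gtr0_norm s0k).
have x0 : 0 <= s0 ^+ k * s ^+ k by rewrite mulr_ge0 ?exprn_ge0// ltW.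
have xK : s0 ^+ k * s ^+ k <= K.
  by rewrite /K mulrC exprMn ler_wpM2r ?(ltW s0k)// lerXn2r ?nnegrE.
set x := s0 ^+ k * s ^+ k in x0 xK *.
have d1 : `|1 - x| <= 1 - c1 * x.
  by rewrite ler_norml /c1; apply/andP; split; nra.
have d2 : normc ((s%:C + e) ^+ k - (s ^+ k)%:C) <=
    c1 / 2 * s ^+ k + C0 * h ^+ (2 * k).
  apply: le_trans (power_perturbation e k s_ge0) _.
  have : (s + normc e) ^+ k <= ((t + h) ^+ 2) ^+ k.
    by rewrite lerXn2r ?nnegrE ?addr_ge0 ?normc_ge0 ?sqr_ge0.
  rewrite -exprM; have := split_pow t h t0 h0.
  rewrite (exprM t) tt; lra.
apply: (@le_trans _ _ (1 + (- (c1 / 2 * s0 ^+ k) * s ^+ k +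
    s0 ^+ k * C0 * h ^+ (2 * k)))); last exact: expR_ge1Dx.
have := ler_wpM2l (ltW s0k) d2.
have -> : s0 ^+ k * (c1 / 2 * s ^+ k + C0 * h ^+ (2 * k)) =
  c1 / 2 * x + s0 ^+ k * C0 * h ^+ (2 * k) by rewrite /x; ring.
have -> : - (c1 / 2 * s0 ^+ k) * s ^+ k = - (c1 / 2 * x) by rewrite /x; ring.
lra.
Qed.

End SymbolBound.

(** * The tail of the Chebyshev coefficients *)

Section CoefficientTail.
Context {R : realType}.

(** The factor (1 + h)^(- l) <= exp(- l h / 2) is shared equally: one half gives the
decay exp(- d h / 4), the other makes the sum over l converge, at the price of
the factor 1 / h. *)
Lemma smoothed_poly_tail (k : nat) (s0 : R) :
  (1 <= k)%N -> 0 < s0 -> (2 * s0) ^+ k < 2 ->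
  exists B C : R, [/\ 0 < B, 0 < C & forall (n : nat) (nu h d : R),
    0 < nu -> nu ^+ (2 * k) = n%:R -> 0 < h <= 1 ->
    \sum_(l < size (smoothed_poly s0%:C k n) | d <= l%:R)
        normc (smoothed_poly s0%:C k n)`_l <=
    B / (nu * h) * expR (C * (n%:R * h ^+ (2 * k)) - d * h / 4)].
Proof.
move=> k1 s00 k2.
have [c [C [c0 C0 symb]]] := symbol_bound s00 k2.
have [B B0 avg] := gaussian_average k1 c0.
exists (10 * B), C; split=> //; first by rewrite mulr_gt0.
move=> n nu h d nu0 nuk /andP[h0 h1].
set p := smoothed_poly s0%:C k n.
(* fine enough to avoid aliasing and to resolve the width 1 / nu *)
pose N := (2 * size p + Num.bound nu)%N.
have nuN : nu <= N%:R.
  rewrite /N natrD; apply: le_trans (ltW (archi_boundP (ltW nu0))) _.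
  by rewrite lerDr.
have pN : (2 * size p <= N)%N by exact: leq_addr.
have N0 : (0 < N)%N by rewrite -(ltr0n R); exact: lt_le_trans nu0 nuN.
pose E := expR (C * (n%:R * h ^+ (2 * k))).
have r0 : 0 < 1 + h by lra.
have coef l : (l < size p)%N -> normc p`_l <= 2 * (1 + h)^-1 ^+ l * (E * (B / nu)).
  move=> lp; have := fourier_coefficient_bound (expi_primitive_root N0)
    (normc_expi _) r0 lp pN.
  move/le_trans; apply; rewrite ler_wpM2l ?mulr_ge0 ?exprn_ge0 ?invr_ge0 ?(ltW r0)//.
  apply: (@le_trans _ _ (E * (N%:R^-1 * \sum_(j < N) expR (- c * (nu ^+ (2 * k) *
     (1 - cos (j%:R * unity_angle N)) ^+ k))))); last first.
    by rewrite ler_wpM2l ?expR_ge0// avg.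
  rewrite mulrCA ler_wpM2l ?invr_ge0// mulr_sumr; apply: ler_sum => j _.
  have z0 : (1 + h)%:C * expi (unity_angle N) ^+ j != 0.
    apply/eqP => /(congr1 (@normc R)); rewrite normcM normcX normc_expi expr1n mulr1.
    by rewrite normc0 normc_real => /normr0_eq0; lra.
  rewrite /p smoothed_poly_scalar ?pnatr_eq0// normcX.
  have := symb h (j%:R * unity_angle N) _ (ltW h0) erefl.
  rewrite -expiX => sb.
  apply: le_trans (lerXn2r n _ _ sb) _; rewrite ?nnegrE ?normc_ge0 ?expR_ge0//.
  rewrite -expRM_natl /E -expRD ler_expR nuk.
  by rewrite le_eqVlt; apply/orP; left; apply/eqP; ring.
have rho : (1 + h)^-1 <= expR (- (h / 2)).
  rewrite expRN lef_pV2 ?posrE ?expR_gt0//.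
  have e := expR_ge1Dx (- (h / 2)).
  rewrite -[expR _]invrK -expRN -[leRHS]invrK lef_pV2 ?posrE ?expR_gt0 ?invr_gt0//.
  apply: le_trans e; rewrite -[(1 + h)^-1]mul1r ler_pdivrMr//; nra.
pose q := expR (- (h / 4)).
have q0 : 0 <= q by exact: expR_ge0.
have q1 : q < 1 by rewrite expR_lt1 oppr_lt0; lra.
have dec (l : nat) : d <= l%:R -> (1 + h)^-1 ^+ l <= expR (- (d * h / 4)) * q ^+ l.
  move=> dl; apply: (@le_trans _ _ (expR (- (h / 2)) ^+ l)).
    by rewrite lerXn2r ?nnegrE ?expR_ge0 ?invr_ge0 ?(ltW r0).
  rewrite /q -!expRM_natl -expRD ler_expR.
  have : d * h <= l%:R * h by rewrite ler_wpM2r// ltW.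
  lra.
apply: (@le_trans _ _ (\sum_(l < size p | d <= l%:R)
    (2 * (E * (B / nu)) * expR (- (d * h / 4))) * q ^+ l)).
  apply: ler_sum => l dl; apply: le_trans (coef l (ltn_ord l)) _.
  rewrite mulrAC -[leRHS]mulrA ler_wpM2l ?dec// !mulr_ge0 ?expR_ge0 ?invr_ge0 ?ltW//.
apply: (@le_trans _ _ (\sum_(l < size p)
    (2 * (E * (B / nu)) * expR (- (d * h / 4))) * q ^+ l)).
  rewrite [leRHS](bigID (fun l : 'I_(size p) => d <= l%:R))/= lerDl.
  apply: sumr_ge0 => l _; rewrite !mulr_ge0 ?exprn_ge0 ?expR_ge0 ?invr_ge0 ?ltW//.
rewrite -mulr_sumr expRD -/E.
have Sq : \sum_(l < size p) q ^+ l <= 5 / h.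
  apply: le_trans (geometric_le _ q0 q1) _.
  apply: le_trans (inv_one_minus_exp _) _; first lra.
  rewrite invf_div; have : 1 <= h^-1 by rewrite invf_ge1.
  lra.
have -> : 10 * B / (nu * h) * (E * expR (- (d * h / 4))) =
  2 * (E * (B / nu)) * expR (- (d * h / 4)) * (5 / h).
  by field; rewrite !lt0r_neq0.
by rewrite ler_wpM2l// !mulr_ge0 ?expR_ge0 ?invr_ge0 ?ltW.
Qed.

End CoefficientTail.

(** * Choice of the radius *)

Section Optimization.
Context {R : realType}.

Lemma root_power (a : R) (j : nat) : (0 < j)%N -> 0 <= a ->
  (a `^ (j%:R^-1)) ^+ j = a.
Proof.
move=> j0 a0; rewrite -powR_mulrn ?powR_ge0// -powRrM mulVf ?powRr1//.
by rewrite pnatr_eq0 -lt0n.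
Qed.

(** In the variable u = d / nu, with y = max(u, 1)^(1/(2k-1)) and h = e y / nu, the
exponent is C e^(2k) y^(2k) - e u y / 4.  When u >= 1 one has u y = y^(2k), the
power of u wanted, and a small e lets the second term win.  When u < 1 the
exponent is bounded, and so is the target.  The restriction d <= k n is what
makes h <= 1 possible. *)
Lemma optimal_shift (k : nat) (B C : R) : (1 <= k)%N -> 0 < B -> 0 < C ->
  exists C' c : R, [/\ 0 < C', 0 < c & forall (n : nat) (d : R),
    (1 <= n)%N -> 0 <= d <= k%:R * n%:R ->
    let nu := n%:R `^ (2 * k%:R)^-1 in
    [/\ 0 < nu, nu ^+ (2 * k) = n%:R &
    exists2 h, 0 < h <= 1 &
      B / (nu * h) * expR (C * (n%:R * h ^+ (2 * k)) - d * h / 4) <=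
      C' * expR (- c * ((d / nu) `^ (2 * k%:R / (2 * k%:R - 1))))]].
Proof.
move=> k1 B0 C0.
have kR : 1 <= k%:R :> R by rewrite ler1n.
(* e k <= 1 serves h <= 1; e <= 1 / (8 C) gives C e^(2k) <= e / 8 *)
pose e : R := Num.min k%:R^-1 (8 * C)^-1.
have e0 : 0 < e by rewrite lt_min !invr_gt0 mulr_gt0// andbT; lra.
have ek : e * k%:R <= 1 by rewrite -ler_pdivlMr ?mul1r ?ge_min ?lexx//; lra.
have eC : C * e <= 8^-1.
  have : C * e <= C * (8 * C)^-1 by rewrite ler_wpM2l ?(ltW C0)// ge_min lexx orbT.
  by rewrite invfM mulrCA divff ?mulr1// lt0r_neq0.
have e1 : e <= 1 by nra.
have eCk : C * e ^+ (2 * k) <= e / 8.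
  have : e ^+ (2 * k) <= e ^+ 2 by rewrite ler_wiXn2l ?(ltW e0)//; lia.
  have := sqr_ge0 e; nra.
exists (B / e * expR (e / 4)), (e / 8); split.
- by rewrite mulr_gt0 ?expR_gt0// divr_gt0.
- by rewrite divr_gt0.
move=> n d n1 /andP[d0 dkn] nu.
have nR : 1 <= n%:R :> R by rewrite ler1n.
have nuE : nu = n%:R `^ ((2 * k)%:R^-1) by rewrite natrM.
have nu0 : 0 < nu by rewrite powR_gt0; lra.
have nuk : nu ^+ (2 * k) = n%:R by rewrite nuE root_power ?muln_gt0//; lra.
have nu1 : 1 <= nu by rewrite -(@powRr0 _ n%:R) ler_powR// invr_ge0; lra.
split=> //.
set u := d / nu; have u0 : 0 <= u by rewrite divr_ge0// ltW.
pose w := Num.max u 1; have w1 : 1 <= w by rewrite le_max lexx orbT.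
pose j := (2 * k).-1; have jE : (2 * k)%N = j.+1 by rewrite /j prednK// muln_gt0.
have j0 : (0 < j)%N by rewrite -ltnS -jE (@leq_trans (2 * 1)%N) ?leq_mul2l.
have jR : j%:R = 2 * k%:R - 1 :> R.
  by have := congr1 (fun i => i%:R : R) jE; rewrite natrM -natr1; lra.
pose y := w `^ (j%:R^-1).
have w0 : 0 <= w by lra.
have yj : y ^+ j = w by exact: root_power.
have y1 : 1 <= y by rewrite -(@powRr0 _ w) ler_powR// invr_ge0.
have y0 : 0 <= y by lra.
have uq : 1 <= u -> u `^ (2 * k%:R / (2 * k%:R - 1)) = y ^+ (2 * k).
  move=> u1; rewrite -jR -natrM mulrC powRrM.
  have -> : u `^ j%:R^-1 = y by rewrite /y /w max_l.
  by rewrite powR_mulrn.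
have ynu : y <= k%:R * nu.
  rewrite -(@ler_pXn2r _ j) ?nnegrE ?mulr_ge0 ?(ltW nu0)//.
  rewrite yj /w ge_max; apply/andP; split; last first.
    by rewrite exprn_ege1//; nra.
  rewrite /u ler_pdivrMr// exprMn -mulrA -exprSr -jE nuk.
  apply: le_trans dkn _; rewrite ler_wpM2r//.
  by rewrite -[leLHS]expr1 ler_weXn2l.
exists (e * y / nu).
  rewrite divr_gt0 ?mulr_gt0//=; last lra.
  rewrite ler_pdivrMr// mul1r; apply: le_trans (ler_wpM2l (ltW e0) ynu) _.
  by rewrite mulrA ler_piMl// ltW.
have -> : nu * (e * y / nu) = e * y by rewrite mulrC divfK// lt0r_neq0.
have -> : n%:R * (e * y / nu) ^+ (2 * k) = e ^+ (2 * k) * y ^+ (2 * k).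
  by rewrite expr_div_n nuk mulrC divfK ?exprMn//; lra.
have -> : d * (e * y / nu) / 4 = e / 4 * (u * y) by rewrite /u; ring.
rewrite -[leRHS]mulrA -expRD; apply: ler_pM.
- by rewrite divr_ge0 ?mulr_ge0 ?ltW//; lra.
- exact: expR_ge0.
- rewrite ler_wpM2l ?(ltW B0)// lef_pV2 ?posrE ?mulr_gt0//; last lra.
  by rewrite ler_peMr// ltW.
rewrite ler_expR.
have yk : 0 <= y ^+ (2 * k) by rewrite exprn_ge0.
have h1 : C * (e ^+ (2 * k) * y ^+ (2 * k)) <= e / 8 * y ^+ (2 * k).
  by rewrite mulrA ler_wpM2r.
have [u1|u1] := leP 1 u.
  rewrite uq//.
  have -> : u * y = y ^+ (2 * k) by rewrite jE exprSr yj /w max_l.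
  by have := e0; lra.
have y1E : y = 1 by rewrite /y /w max_r ?powR1//; lra.
rewrite y1E expr1n in h1 *.
have : u `^ (2 * k%:R / (2 * k%:R - 1)) <= 1.
  rewrite -[leRHS](powRr0 u).
  have [->|un0] := eqVneq u 0.
    by rewrite powR0 ?powRr0// mulf_neq0 ?invr_eq0//; lra.
  apply: ger_powR; first by apply/andP; split; [rewrite lt_def un0|lra].
  by rewrite divr_ge0//; lra.
by have := e0; nra.
Qed.

End Optimization.

(** * Finite propagation *)

Section Propagation.
Context {R : realType} {X : metricType R} (pi : X -> {posnum R}).
Implicit Types (u v : ell2 pi) (y : X) (r : R).

Definition supported_in_ball y r u := forall x, r < mdist x y -> u x = 0.

Lemma supported_delta y : supported_in_ball y 0 (ell2_delta pi y).
Proof.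
move=> x; rewrite /ell2_delta /=; case: eqP => // ->.
by rewrite mdistxx ltxx.
Qed.

Lemma supportedB y r u v : supported_in_ball y r u -> supported_in_ball y r v ->
  supported_in_ball y r (u - v).
Proof. by move=> hu hv x rx; rewrite ell2_evalB hu// hv// subrr. Qed.

Lemma supportedZ y r (a : R[i]) u : supported_in_ball y r u ->
  supported_in_ball y r (a *: u).
Proof. by move=> hu x rx; rewrite ell2_evalZ hu// mulr0. Qed.

Lemma supportedW y r r' u : r <= r' -> supported_in_ball y r u ->
  supported_in_ball y r' u.
Proof. by move=> rr hu x /(le_lt_trans rr); exact: hu. Qed.

Lemma supported_kernel (T : ell2 pi -> ell2 pi) (m : X -> X -> R[i]) y r u :
  has_kernel T m -> (forall x z, 1 < mdist x z -> m x z = 0) ->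
  supported_in_ball y r u -> supported_in_ball y (r + 1) (T u).
Proof.
move=> hT m0 hu x rx; have := hT u x.
rewrite (_ : partial_sum _ = fun=> (0 : R[i]^o)); last first.
  apply/funext => A; rewrite /partial_sum big1// => z _.
  have [xz|xz] := ltP 1 (mdist x (val z)); first by rewrite m0// mul0r.
  rewrite hu ?mulr0//.
  by have := metric_triangle x (val z) y; move: rx xz; lra.
move/(cvg_unique (@norm_hausdorff _ R[i]^o)) => /(_ _ (cvg_cst _)) E.
by rewrite E.
Qed.

Lemma supported_smoothed (T : ell2 pi -> ell2 pi) (m : X -> X -> R[i]) y k n :
  has_kernel T m -> (forall x z, 1 < mdist x z -> m x z = 0) ->
  supported_in_ball y (k%:R * n%:R) (iter n (smoothed T k) (ell2_delta pi y)).
Proof.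
move=> hT m0; elim: n => [|n IH]; first by rewrite mulr0; exact: supported_delta.
rewrite iterS /smoothed -natr1 mulrDr mulr1.
apply: supportedB; first by apply: supportedW IH; rewrite lerDl ler0n.
elim: k {IH} (iter n _ _) (k%:R * n%:R : R) IH => [|k IHk] u r hu /=.
  by rewrite addr0.
have := IHk u r hu => hk.
rewrite -natr1 addrA; apply: supportedB; last exact: supported_kernel hT m0 hk.
by apply: supportedW hk; lra.
Qed.

Lemma supported_cheb (T : ell2 pi -> ell2 pi) (m : X -> X -> R[i]) y (a : R[i]) j :
  has_kernel T m -> (forall x z, 1 < mdist x z -> m x z = 0) ->
  supported_in_ball y j%:R
    (cheb (fun u => u - a *: (u - T u)) (ell2_delta pi y) j).
Proof.
move=> hT m0.
have step r u : supported_in_ball y r u ->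
    supported_in_ball y (r + 1) (u - a *: (u - T u)).
  move=> hu; have hu1 : supported_in_ball y (r + 1) u.
    by apply: supportedW hu; lra.
  apply: supportedB => //; apply: supportedZ; apply: supportedB => //.
  exact: supported_kernel hT m0 hu.
set A := fun u => _.
have [] : supported_in_ball y j%:R (cheb A (ell2_delta pi y) j) /\
    supported_in_ball y j.+1%:R (cheb A (ell2_delta pi y) j.+1).
  elim: j => [|j [IH1 IH2]].
    split; first exact: supported_delta.
    by rewrite -natr1; apply: step; exact: supported_delta.
  split=> //; rewrite [cheb _ _ _]/= -/(cheb A _ j.+1).
  apply: supportedB; first by apply: supportedZ; rewrite -natr1; exact: step.
  by apply: supportedW IH1; rewrite ler_nat -addn2 leq_addr.
by [].
Qed.

End Propagation.

Lemma ell2_norm_delta (R : realType) (X : choiceType) (pi : X -> {posnum R}) y :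
  ell2_norm (ell2_delta pi y) ^+ 2 = (pi y)%:num.
Proof.
rewrite ell2_norm_sqr /sqnorm (_ : esum _ _ = (pi y)%:num%:E)//.
rewrite -[RHS](@esum_set1 R X y (fun y => (pi y)%:num%:E)) ?lee_fin//.
rewrite [RHS]esum_mkcond; apply: eq_esum => x _ /=.
case: ifPn => [/set_mem -> | /negP xy].
  by rewrite eqxx normc1 expr1n mul1r.
case: eqP => [xE|_]; last by rewrite normc0 expr0n mul0r.
by case: xy; rewrite xE; exact/mem_set.
Qed.

(** * The kernel estimate *)

Section KernelEstimate.
Context {R : realType} {X : metricType R} (pi : X -> {posnum R}).

(** M_k^n applied to the delta at y is the Chebyshev combination of the vectors
T_l(A) delta_y, each of norm at most pi(y)^(1/2) and vanishing at x for
l < d(x, y); evaluation at x costs pi(x)^(-1/2). *)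
Lemma smoothed_entry_le (M : {linear ell2 pi -> ell2 pi}) (m : X -> X -> R[i])
    (a s0 : R) (k n : nat) (x y : X) :
  0 < s0 -> contraction_op M -> normal_op M -> has_kernel M m ->
  (forall x y, 1 < mdist x y -> m x y = 0) -> 1 - a <= 2 * s0 ->
  spectrum M `<=` [set r%:C | r in [set r : R | a <= r <= 1]] ->
  normc (iter n (smoothed M k) (ell2_delta pi y) x) <=
  Num.sqrt ((pi y)%:num / (pi x)%:num) *
  \sum_(l < size (smoothed_poly s0%:C k n) | mdist x y <= l%:R)
        normc (smoothed_poly s0%:C k n)`_l.
Proof.
move=> s00 Mc Mn hM m0 as0 spec.
have Msym : forall u v, dot (M u) v = dot u (M v).
  by apply: normal_real_spectrum_symmetric => // z /spec[r _ <-].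
have Mlow u : a * ell2_norm u ^+ 2 <= dot (M u) u.
  apply: spectrum_lower_bound => // r /spec[r' /andP[ar _] /complexI <-] //.
have Mhigh u : dot (M u) u <= ell2_norm u ^+ 2.
  apply: le_trans (dot_le _ _) _; rewrite expr2 ler_wpM2r ?ell2_norm_ge0//.
pose A (u : ell2 pi) : ell2 pi := u - (s0^-1)%:C *: (u - M u).
have Alin : linear A.
  move=> c u v; rewrite /A linearP /=.
  have -> : c *: u + v - (c *: M u + M v) = c *: (u - M u) + (v - M v).
    by rewrite scalerBr opprD addrACA.
  rewrite (scalerDr (s0^-1)%:C) opprD addrACA; congr (_ + _).
  by rewrite [RHS]scalerBr !scalerA mulrC.
have Asym u v : dot (A u) v = dot u (A v).
  by rewrite /A !(dotBl, dotBr, dotZl, dotZr) Msym.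
have Ac : contraction_op A.
  apply: symmetric_contraction => // u.
  rewrite /A dotBl dotZl dotBl dot_self ler_norml.
  have lo := Mlow u; have hi := Mhigh u; have n0 := sqr_ge0 (ell2_norm u).
  set w := ell2_norm u ^+ 2 in lo hi n0 *; set z := dot (M u) u in lo hi *.
  have zs : w - z <= 2 * s0 * w by nra.
  have i0 : 0 <= s0^-1 * (w - z) by rewrite mulr_ge0 ?invr_ge0 ?(ltW s00)// subr_ge0.
  have i1 : s0^-1 * (w - z) <= 2 * w.
    rewrite mulrC ler_pdivrMr//; lra.
  by apply/andP; split; lra.
set p := smoothed_poly _ _ _; set e := ell2_delta pi y.
have two0 : 2%:R != 0 :> R[i] by rewrite pnatr_eq0.
have -> : iter n (smoothed M k) e = cheb_comb A e p.
  rewrite cheb_comb_smoothed//; apply: eq_iter => w; rewrite /smoothed.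
  congr (_ - _); apply: eq_iter => u.
  rewrite /A subKr scalerA -rmorphM divff ?lt0r_neq0//.
  by rewrite rmorph1 scale1r.
rewrite /cheb_comb ell2_eval_sum.
have px : 0 < (pi x)%:num by [].
have entry l : normc (cheb A e l x) <= Num.sqrt ((pi y)%:num / (pi x)%:num).
  rewrite -ler_sqr ?nnegrE ?normc_ge0 ?sqrtr_ge0// sqr_sqrtr ?divr_ge0//.
  rewrite ler_pdivlMr//; apply: le_trans (ell2_eval_le _ _) _.
  rewrite -(ell2_norm_delta pi y) ler_sqr ?nnegrE ?ell2_norm_ge0//.
  exact: cheb_contraction.
rewrite mulr_sumr [leRHS]big_mkcond.
apply: le_trans (normc_sum _ _ _) _; apply: ler_sum => l _.
rewrite ell2_evalZ normcM.
case: ifPn => [_|]; first by rewrite mulrC ler_wpM2r ?normc_ge0.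
rewrite -ltNge => lx.
by rewrite (supported_cheb (s0^-1)%:C hM m0 lx) normc0 mulr0.
Qed.

End KernelEstimate.

Theorem theorem4p1 (R : realType) (k : nat) (s0 : R) :
  (1 <= k)%N -> 0 < s0 < 2 `^ (-1 + k%:R^-1) ->
  exists C c : R, [/\ 0 < C, 0 < c &
    forall (X : metricType R) (pi : X -> {posnum R})
      (M : {linear ell2 pi -> ell2 pi}) (m : X -> X -> R[i]) (a : R),
    countable [set: X] ->
    contraction_op M -> normal_op M ->
    has_kernel M m -> (forall x y : X, 1 < mdist x y -> m x y = 0) ->
    -1 <= a < 1 -> 1 - a <= 2 * s0 ->
    spectrum M `<=` [set r%:C | r in [set r : R | a <= r <= 1]] ->
    forall (n : nat) (mkn : X -> X -> R[i]), (1 <= n)%N ->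
    has_kernel (iter n (smoothed M k)) mkn ->
    forall x y : X,
    `|mkn x y| <=
      (C * ((pi y)%:num / (pi x)%:num) `^ 2^-1 *
       expR (- c * ((mdist x y / n%:R `^ (2 * k%:R)^-1)
                      `^ (2 * k%:R / (2 * k%:R - 1)))))%:C].
Proof.
move=> k1 /andP[s00 s0k].
have k2 : (2 * s0) ^+ k < 2.
  have : 2 * s0 < 2 `^ (k%:R^-1).
    have -> : 2 `^ (k%:R^-1) = 2 * 2 `^ (-1 + k%:R^-1) :> R.
      rewrite powRD; last by rewrite pnatr_eq0 implybT.
      by rewrite powR_inv1// mulrA divff ?mul1r// pnatr_eq0.
    by rewrite ltr_pM2l.
  rewrite -(@ltr_pXn2r _ k) ?nnegrE ?powR_ge0 ?mulr_ge0 ?(ltW s00)//.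
  by rewrite root_power.
have [B [C [B0 C0 tail]]] := smoothed_poly_tail k1 s00 k2.
have [C' [c [C'0 c0 opt]]] := optimal_shift k1 B0 C0.
exists C', c; split=> // X pi M m a _ Mc Mn hM m0 _ as0 spec n mkn n1 hn x y.
rewrite (has_kernel_delta x y hn).
rewrite -[X in X <= _]/((normc _)%:C) lecR powR12_sqrt; last by rewrite divr_ge0.
set S := Num.sqrt _; have S0 : 0 <= S := sqrtr_ge0 _.
have [far|near] := ltP (k%:R * n%:R) (mdist x y).
  rewrite (supported_smoothed hM m0 far) normc0.
  by rewrite !mulr_ge0 ?expR_ge0// ltW.
have d0 := mdist_ge0 x y.
have [|nu0 nuk [h h01 hb]] := opt n (mdist x y) n1; first by rewrite d0.
apply: le_trans (smoothed_entry_le k n x y s00 Mc Mn hM m0 as0 spec) _.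
rewrite (mulrC C') -[leRHS]mulrA ler_wpM2l//.
by apply: le_trans hb; exact: tail.
Qed.
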